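(* Let $k$ be a commutative ring, $R$ a $k$-algebra, and $L$ a $\times_R$-bialgebra that is finitely generated projective as a left $\overline R$-module. Let $S$ be a $k$-algebra Morita equivalent to $R$ (with a fixed strict Morita context), and let $\widetilde L$ be the $\times_S$-bialgebra obtained from $L$ by Morita base change. Then $\widetilde L$ is finitely generated projective as a left $\overline S$-module, and its left dual $\times_S$-bialgebra $\widetilde L^\vee$ is isomorphic to the $\times_S$-bialgebra $\widetilde{L^\vee}$ that is obtained from the left dual $L^\vee$ of $L$ by Morita base change (along the same Morita context).
   Context: $k$ is a commutative ring; algebras and unadorned tensor products are over $k$. For a $k$-algebra $R$, $\overline R$ is the opposite algebra with anti-isomorphism $r\mapsto\overline r$, $R^e=R\otimes\overline R$, $r\overline s=r\otimes\overline s$. An $R^e$-ring is a $k$-algebra with an algebra map from $R^e$. Left $R^e$-modules are $R$-bimodules via $r\overline s\,m=rms$; their tensor product is $M\diamond_RN=M\otimes N/\langle\overline rm\otimes n-m\otimes rn\rangle$ with action $r\overline s(m\otimes n)=rm\otimes\overline sn$. For $R^e$-bimodules, $M\times_RN\subset M\diamond_RN$ consists of the $\sum m_i\otimes n_i$ with $\sum m_i\overline s\otimes n_i=\sum m_i\otimes n_is$ for all $s\in R$; for $R^e$-rings it is an $R^e$-ring with componentwise multiplication and $r\overline s\mapsto r\otimes\overline s$. $\operatorname{End}_k(R)$ is an $R^e$-ring via $r\overline s\mapsto(t\mapsto rts)$. A $\times_R$-bialgebra is an $R^e$-ring $L$ with $R^e$-ring maps $\Delta\colon L\to L\times_RL$,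 $\Delta(\ell)=\ell_{(1)}\otimes\ell_{(2)}$, and $\varepsilon\colon L\to\operatorname{End}_k(R)$, with $\Delta$ coassociative in $L\diamond_RL\diamond_RL$ and $\overline{\varepsilon(\ell_{(2)})(1)}\,\ell_{(1)}=\ell=\varepsilon(\ell_{(1)})(1)\,\ell_{(2)}$. Morita base change. Let $(R,S,P,Q,f,g)$ be a strict Morita context: bimodules ${}_SP_R$, ${}_RQ_S$ and bimodule isomorphisms $f\colon P\otimes_RQ\to S$, $g\colon Q\otimes_SP\to R$ satisfying the usual associativity conditions; write $f(p\otimes q)=pq$, $g(q\otimes p)=qp$, $f^{-1}(1)=p_i\otimes q^i$, $g^{-1}(1)=q_i\otimes p^i$ (summation understood). Put $P^e=P\otimes\overline Q$ (an $S^e$-$R^e$-bimodule), $Q^e=Q\otimes\overline P$ (an $R^e$-$S^e$-bimodule), $p\overline q=p\otimes\overline q$, $q\overline p=q\otimes\overline p$. The $\times_S$-bialgebra obtained from a $\times_R$-bialgebra $L$ by Morita base change is $\widetilde L=P^e\otimes_{R^e}L\otimes_{R^e}Q^e$ with product $(p_1\overline{q_1}\otimes\ell\otimes q_2\overline{p_2})(p_3\overline{q_3}\otimes m\otimes q_4\overline{p_4})=p_1\overline{q_1}\otimes\ell(q_2p_3)(\overline{q_3p_2})m\otimes q_4\overline{p_4}$, ring map $S^e\to\widetilde L$, $s\overline t\mapsto sp_i\overline{q^jt}\otimes1\otimes q^i\overline{p_j}$, comultiplication $\Delta(p_1\overline{q_1}\otimes\ell\otimes q_2\overline{p_2})=(p_1\overline{q_i}\otimes\ell_{(1)}\otimes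 q_2\overline{p_j})\otimes(p^i\overline{q_1}\otimes\ell_{(2)}\otimes q^j\overline{p_2})$, and counit $\varepsilon(p_1\overline{q_1}\otimes\ell\otimes q_2\overline{p_2})(s)=p_1\,\varepsilon(\ell)(q_2sp_2)\,q_1$. Left dual. For a $\times_R$-bialgebra $L$ let $L^\vee=\operatorname{Hom}_{\overline R-}(L,R)$, the left $\overline R$-linear maps, where $\overline r\cdot x=xr$ on $R$; so $\xi(\overline v\ell)=\xi(\ell)v$. It is an $R^e$-ring with $R^e$-bimodule structure $(r\overline s\,\xi\,t\overline u)(\ell)=r\,\xi(t\ell u\overline s)$, product $(\xi\zeta)(\ell)=\xi(\zeta(\ell_{(1)})\ell_{(2)})$ and unit $\ell\mapsto\varepsilon(\ell)(1)$. If $L$ is finitely generated projective as a left $\overline R$-module, then (known) $L^\vee$ is a $\times_R$-bialgebra, called the left dual of $L$, whose comultiplication is determined by $\xi(\ell m)=\xi_{(1)}\bigl(\ell\,\overline{\xi_{(2)}(m)}\bigr)$ for $\ell,m\in L$, and whose counit satisfies $\varepsilon(\xi)(1)=\xi(1)$; equivalently evaluation $L^\vee\otimes L\to R$ is a skew pairing. *)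

(* Defs.v *)
From HB Require Import structures.
From mathcomp Require Import all_boot all_algebra.
From mathcomp Require Import boolp freeg.

Set Implicit Arguments.
Unset Strict Implicit.
Unset Printing Implicit Defensive.

Import GRing.Theory.
Local Open Scope ring_scope.
Local Open Scope quotient_scope.

(* Algebras are nontrivial associative unital algebras (algType), modules are
   modules over the nontrivial commutative ring k. *)

Local Ltac ia := repeat (move=> ?).

Section Presented.
Context (k : comNzRingType) (X : choiceType) (rel : {freeg X / k} -> Prop).
Implicit Types (x y z : {freeg X / k}) (a b : k).

Definition submodule (N : {freeg X / k} -> Prop) :=
  N 0 /\ forall a x y, N x -> N y -> N (a *: x + y).

Definition spanned x :=
  forall N, submodule N -> (forall y, rel y -> N y) -> N x.

Lemma spanned_submodule : submodule spanned.
Proof.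
split=> [N [] // | a x y sx sy N sN relN].
by have [_ +] := sN; apply; [apply: sx | apply: sy].
Qed.

Definition pres_eqv x y := `[< spanned (x - y) >].

Lemma pres_eqv_equiv : equiv_class_of pres_eqv.
Proof.
have [s0 sl] := spanned_submodule.
have sN x : spanned x -> spanned (- x).
  by move=> sx; rewrite -[- x]addr0 -scaleN1r; apply: sl.
have sD x y : spanned x -> spanned y -> spanned (x + y).
  by move=> sx sy; rewrite -[x]scale1r; apply: sl.
split=> [x | x y | y x z].
- by apply/asboolP; rewrite subrr.
- by apply/asboolP/asboolP => /sN; rewrite opprB.
- move=> /asboolP xy /asboolP yz; apply/asboolP.
  by rewrite -[x](subrK y) -addrA; apply: sD.
Qed.

Canonical pres_equiv := EquivRelPack pres_eqv_equiv.

(* The k-module with generators X and relators rel: the free module on X modulo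
   the submodule generated by rel. *)
Definition presmod := {eq_quot pres_equiv}.

HB.instance Definition _ := Quotient.on presmod.
HB.instance Definition _ := Choice.on presmod.
HB.instance Definition _ := EqQuotient.on presmod.

Definition prespi x : presmod := \pi_presmod x.

Lemma prespi_eq x y : prespi x = prespi y <-> spanned (x - y).
Proof.
split=> [/eqmodP /asboolP // | H].
by apply/eqmodP/asboolP.
Qed.

Lemma presreprK (u : presmod) : prespi (repr u) = u.
Proof. exact: reprK. Qed.

Let pi_lin a x x' y y' : prespi x = prespi x' -> prespi y = prespi y' ->
  prespi (a *: x + y) = prespi (a *: x' + y').
Proof.
have [s0 sl] := spanned_submodule.
move=> /prespi_eq sx /prespi_eq sy; apply/prespi_eq.
by rewrite opprD addrACA -scalerBr; apply: sl.
Qed.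

Definition pres_add (u v : presmod) : presmod := prespi (repr u + repr v).
Definition pres_opp (u : presmod) : presmod := prespi (- repr u).
Definition pres_scale a (u : presmod) : presmod := prespi (a *: repr u).

Lemma prespiD x y : prespi (x + y) = pres_add (prespi x) (prespi y).
Proof.
have := @pi_lin 1 x (repr (prespi x)) y (repr (prespi y)).
by rewrite !scale1r; apply; rewrite presreprK.
Qed.
Lemma prespiZ a x : prespi (a *: x) = pres_scale a (prespi x).
Proof.
have := @pi_lin a x (repr (prespi x)) 0 0.
by rewrite !addr0; apply; rewrite ?presreprK.
Qed.
Lemma prespiN x : prespi (- x) = pres_opp (prespi x).
Proof. by rewrite -scaleN1r prespiZ /pres_scale scaleN1r. Qed.

Let addA : associative pres_add.
Proof.
move=> u v w; rewrite -[u]presreprK -[v]presreprK -[w]presreprK.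
by rewrite -!prespiD addrA.
Qed.
Let addC : commutative pres_add.
Proof. by move=> u v; rewrite /pres_add addrC. Qed.
Let add0 : left_id (prespi 0) pres_add.
Proof. by move=> u; rewrite -[u]presreprK -prespiD add0r. Qed.
Let addN : left_inverse (prespi 0) pres_opp pres_add.
Proof. by move=> u; rewrite -[u]presreprK -prespiN -prespiD addNr. Qed.

HB.instance Definition _ := GRing.isZmodule.Build presmod addA addC add0 addN.

Let scaleA a b (u : presmod) : pres_scale a (pres_scale b u) = pres_scale (a * b) u.
Proof. by rewrite -[u]presreprK -!prespiZ scalerA. Qed.
Let scale1 : left_id 1 pres_scale.
Proof. by move=> u; rewrite -[u]presreprK -!prespiZ scale1r. Qed.
Let scaleDr : right_distributive pres_scale +%R.
Proof.
move=> a u v; rewrite -[u]presreprK -[v]presreprK.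
by rewrite -[prespi _ + prespi _]prespiD -!prespiZ scalerDr prespiD.
Qed.
Let scaleDl (u : presmod) : {morph pres_scale^~ u : a b / a + b}.
Proof. by move=> a b; rewrite -[u]presreprK -!prespiZ scalerDl prespiD. Qed.

HB.instance Definition _ := GRing.Zmodule_isLmodule.Build k presmod
  scaleA scale1 scaleDr scaleDl.

Lemma prespi_linear : linear prespi.
Proof. by move=> a x y; rewrite prespiD prespiZ. Qed.

Definition pgen (x : X) : presmod := prespi << x >>.

(* The sum of the h x, for a chosen expression of u as a combination of
   generators x. When h is compatible with the relators, it does not depend on
   this choice and psum h is the linear map induced by h (psum_pi, psum_linear,
   psumE). *)
Definition psum (G : lmodType k) (h : X -> G) (u : presmod) : G :=
  fglift h (repr u).

Definition compatible (G : lmodType k) (h : X -> G) :=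
  forall y, rel y -> fglift h y = 0.

Lemma pres_ind (P : presmod -> Prop) :
  P 0 -> (forall a (x : X) u, P u -> P (a *: pgen x + u)) -> forall u, P u.
Proof.
move=> P0 PS u; rewrite -[u]presreprK.
elim/freeg_ind_dom0: (repr u) => [//|a x D _ _ PD].
have -> : << a *g x >> = a *: << x >> :> {freeg X / k}.
  by apply/eqP/freeg_eqP=> y; rewrite coeffZ !coeffU mul1r.
by rewrite prespi_linear; apply: PS.
Qed.

End Presented.

Section Psum.
Context (k : comNzRingType).

Section Fg.
Context (X : choiceType) (G : lmodType k) (h : X -> G).
Implicit Type x y : {freeg X / k}.
Lemma fgliftD x y : fglift h (x + y) = fglift h x + fglift h y.
Proof.
have lB := lift_is_additive h.
have l0 : fglift h 0 = 0 by rewrite -[X in fglift h X](subrr 0) lB subrr.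
by rewrite -[y in x + y]opprK lB -[- y]add0r lB l0 sub0r opprK.
Qed.
Lemma fglift0 : fglift h 0 = 0.
Proof. by rewrite -[X in fglift h X](subrr 0) lift_is_additive subrr. Qed.
Lemma fgliftZ a x : fglift h (a *: x) = a *: fglift h x.
Proof.
elim/freeg_ind_dom0: x => [|b z D _ _ IH].
  by rewrite scaler0 fglift0 scaler0.
rewrite scalerDr !fgliftD scalerDr IH; congr (_ + _).
have -> : a *: << b *g z >> = << (a * b) *g z >> :> {freeg X / k}.
  by apply/eqP/freeg_eqP=> y; rewrite coeffZ !coeffU mulrA.
by rewrite !liftU scalerA.
Qed.
Lemma fglift_gen z : fglift h << z >> = h z.
Proof. by rewrite liftU scale1r. Qed.
End Fg.

Lemma fglift_linP (X : choiceType) (G : lmodType k) (h h1 h2 : X -> G) a x :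
  (forall z, h z = a *: h1 z + h2 z) ->
  fglift h x = a *: fglift h1 x + fglift h2 x.
Proof.
move=> H; elim/freeg_ind_dom0: x => [|b z D _ _ IH].
  by rewrite !fglift0 scaler0 addr0.
rewrite !fgliftD !liftU IH H scalerDr !scalerDr addrACA; congr (_ + _ + _).
by rewrite !scalerA mulrC.
Qed.

Lemma fglift_comp (X : choiceType) (G G' : lmodType k) (F : G -> G')
  (h : X -> G) x : linear F -> F (fglift h x) = fglift (F \o h) x.
Proof.
move=> lF; have F0 : F 0 = 0.
  by rewrite -(subrr (0 : G)) addrC -scaleN1r lF scaleN1r addrC subrr.
elim/freeg_ind_dom0: x => [|b z D _ _ IH].
  by rewrite !fglift0.
by rewrite !fgliftD !liftU lF IH.
Qed.

Lemma fglift_swap (X Y : choiceType) (G : lmodType k) (h : X -> Y -> G) x y :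
  fglift (fun z => fglift (h z) y) x = fglift (fun w => fglift (h^~ w) x) y.
Proof.
elim/freeg_ind_dom0: x => [|b z D _ _ IH].
  rewrite fglift0; elim/freeg_ind_dom0: y => [|b z D _ _ IH].
    by rewrite fglift0.
  by rewrite fgliftD -IH liftU fglift0 scaler0 addr0.
rewrite fgliftD liftU IH; symmetry.
by apply: fglift_linP => w; rewrite fgliftD liftU.
Qed.

Context (X : choiceType) (rel : {freeg X / k} -> Prop).
Local Notation M := (presmod rel).

Lemma pgen_rel x : rel x -> prespi rel x = 0.
Proof. by move=> rx; apply/prespi_eq; rewrite subr0 => N _; apply. Qed.

Lemma prespi_lift x : prespi rel x = fglift (pgen rel) x.
Proof.
have pl := @prespi_linear _ _ rel.
elim/freeg_ind_dom0: x => [|b z D _ _ IH]; first by rewrite fglift0.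
rewrite fgliftD liftU -IH -pl; congr (prespi _ (_ + _)).
by apply/eqP/freeg_eqP=> y; rewrite coeffZ !coeffU mul1r.
Qed.

Lemma compatible_pgen : compatible rel (pgen rel).
Proof. by move=> y ry; rewrite -prespi_lift pgen_rel. Qed.

Lemma psum_pgen (u : M) : psum (pgen rel) u = u.
Proof. by rewrite /psum -prespi_lift presreprK. Qed.

Section Compat.
Context (G : lmodType k) (h : X -> G) (ch : compatible rel h).

Lemma psum_pi x : psum h (prespi rel x) = fglift h x.
Proof.
have /prespi_eq H : prespi rel (repr (prespi rel x)) = prespi rel x.
  exact: presreprK.
have : fglift h (repr (prespi rel x) - x) = 0.
  apply: (H (fun y => fglift h y = 0)) => //.
  split=> [|a y z hy hz]; first exact: fglift0.
  by rewrite fgliftD fgliftZ hy hz scaler0 addr0.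
by rewrite lift_is_additive => /eqP; rewrite subr_eq0 => /eqP.
Qed.

Lemma psum_linear : linear (psum (rel := rel) h).
Proof.
move=> a u v; rewrite -[u]presreprK -[v]presreprK -prespi_linear !psum_pi.
by rewrite fgliftD fgliftZ.
Qed.

Lemma psumE x : psum h (pgen rel x) = h x.
Proof. by rewrite psum_pi fglift_gen. Qed.

End Compat.

Lemma psum_linP (G : lmodType k) (h h1 h2 : X -> G) a (u : M) :
  (forall z, h z = a *: h1 z + h2 z) -> psum h u = a *: psum h1 u + psum h2 u.
Proof. exact: fglift_linP. Qed.

Lemma psum_comp (G G' : lmodType k) (F : G -> G') (h : X -> G) (u : M) :
  linear F -> F (psum h u) = psum (F \o h) u.
Proof. exact: fglift_comp. Qed.

Lemma eq_psum (G : lmodType k) (h h' : X -> G) (u : M) :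
  h =1 h' -> psum h u = psum h' u.
Proof. by move=> /funext ->. Qed.

Lemma linear_pres_ext (G : lmodType k) (F F' : M -> G) :
  linear F -> linear F' -> (forall x, F (pgen rel x) = F' (pgen rel x)) ->
  F =1 F'.
Proof.
move=> lF lF' H; elim/pres_ind => [|a x u IH]; last by rewrite lF lF' H IH.
have F0 (E : M -> G) : linear E -> E 0 = 0.
  move=> lE; by rewrite -(subrr (0 : M)) addrC -scaleN1r lE scaleN1r addrC subrr.
by rewrite !F0.
Qed.

End Psum.

Lemma psum_swap (k : comNzRingType) (X Y : choiceType) rX rY (G : lmodType k)
    (h : X -> Y -> G) (u : presmod rX) (v : presmod rY) :
  psum (fun z => psum (h z) v) u = psum (fun w => psum (h^~ w) u) v.
Proof. exact: fglift_swap. Qed.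

Section Lin.
Context (k : comNzRingType) (U V : lmodType k) (F : U -> V) (lF : linear F).
Lemma linf0 : F 0 = 0.
Proof. by rewrite -(subrr (0 : U)) addrC -scaleN1r lF scaleN1r addrC subrr. Qed.
Lemma linfD x y : F (x + y) = F x + F y.
Proof. by rewrite -[x]scale1r lF !scale1r. Qed.
Lemma linfZ a x : F (a *: x) = a *: F x.
Proof. by rewrite -[a *: x]addr0 lF linf0 addr0. Qed.
Lemma linf_sum I (s : seq I) (f : I -> U) :
  F (\sum_(i <- s) f i) = \sum_(i <- s) F (f i).
Proof.
elim: s => [|i s IH]; first by rewrite !big_nil linf0.
by rewrite !big_cons linfD IH.
Qed.
End Lin.

Section Psum2.
Context (k : comNzRingType) (X Y : choiceType) (rel : {freeg (X * Y) / k} -> Prop).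

(* Sweedler sum: if u is the sum of the x_i (x) y_i, then sum2 h u is the sum of
   the h x_i y_i. The expression of u as a sum is the chosen one (see psum), but
   the value does not depend on it when h is bilinear and balanced. *)
Definition sum2 (G : lmodType k) (h : X -> Y -> G) (u : presmod rel) : G :=
  psum (fun z => h z.1 z.2) u.

Lemma eq_sum2 (G : lmodType k) (h h' : X -> Y -> G) u :
  (forall x y, h x y = h' x y) -> sum2 h u = sum2 h' u.
Proof. by move=> H; apply: eq_psum => -[x y]; apply: H. Qed.

Lemma sum2_linP (G : lmodType k) (h h1 h2 : X -> Y -> G) a u :
  (forall x y, h x y = a *: h1 x y + h2 x y) ->
  sum2 h u = a *: sum2 h1 u + sum2 h2 u.
Proof. by move=> H; apply: psum_linP => -[x y]; apply: H. Qed.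

Lemma sum2_comp (G G' : lmodType k) (F : G -> G') (h : X -> Y -> G) u :
  linear F -> F (sum2 h u) = sum2 (fun x y => F (h x y)) u.
Proof. exact: psum_comp. Qed.

End Psum2.

Lemma sum2_swap (k : comNzRingType) (X Y X' Y' : choiceType) rX rY
    (G : lmodType k) (h : X -> Y -> X' -> Y' -> G)
    (u : presmod (k := k) rX) (v : presmod (k := k) rY) :
  sum2 (fun x y => sum2 (h x y) v) u =
  sum2 (fun x' y' => sum2 (fun x y => h x y x' y') u) v.
Proof. by rewrite /sum2 psum_swap. Qed.

Section Basics.
Context (k : comNzRingType).

Section Rels.
Context (X : choiceType) (rel : {freeg X / k} -> Prop).

(* Relators expressing that a generator is linear in one of its entries. *)
Definition lin_relator (a : k) (x y z : X) : {freeg X / k} :=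
  << x >> - (a *: << y >> + << z >>).

Lemma pgen_lin a x y z : rel (lin_relator a x y z) ->
  pgen rel x = a *: pgen rel y + pgen rel z.
Proof.
move=> /pgen_rel /eqP; rewrite prespi_lift /lin_relator lift_is_additive.
by rewrite fgliftD fgliftZ !fglift_gen subr_eq0 => /eqP.
Qed.

Lemma pgen_eq x y : rel (<< x >> - << y >>) -> pgen rel x = pgen rel y.
Proof.
move=> /pgen_rel /eqP; rewrite prespi_lift lift_is_additive.
by rewrite !fglift_gen subr_eq0 => /eqP.
Qed.

Lemma lift_lin_relator (G : lmodType k) (h : X -> G) a x y z :
  h x = a *: h y + h z -> fglift h (lin_relator a x y z) = 0.
Proof.
move=> H; rewrite /lin_relator lift_is_additive fgliftD fgliftZ !fglift_gen H.
by rewrite subrr.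
Qed.

Lemma lift_eq_relator (G : lmodType k) (h : X -> G) x y :
  h x = h y -> fglift h (<< x >> - << y >>) = 0.
Proof. by move=> H; rewrite lift_is_additive !fglift_gen H subrr. Qed.
End Rels.

(* An A-B-bimodule over k: both actions restrict to the same action of k. *)
Record bimod (A B : algType k) := Bimod {
  bimod_car :> lmodType k;
  lact : A -> bimod_car -> bimod_car;
  ract : bimod_car -> B -> bimod_car;
  lact_lin : forall s, linear (lact s);
  lact_linl : forall m, linear (lact^~ m);
  ract_lin : forall r, linear (ract^~ r);
  ract_linr : forall m, linear (ract m);
  lact1 : forall m, lact 1 m = m;
  lactM : forall s t m, lact (s * t) m = lact s (lact t m);
  ract1 : forall m, ract m 1 = m;
  ractM : forall m r t, ract m (r * t) = ract (ract m r) t;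
  lractA : forall s m r, ract (lact s m) r = lact s (ract m r) }.

Section Btens.
Context (A B C : algType k) (M : bimod A B) (N : bimod B C).

Inductive btens_rel : {freeg (M * N)%type / k} -> Prop :=
| BtensL a m m' n : btens_rel (lin_relator a (a *: m + m', n) (m, n) (m', n))
| BtensR a m n n' : btens_rel (lin_relator a (m, a *: n + n') (m, n) (m, n'))
| BtensM m b n : btens_rel (<< (ract m b, n) >> - << (m, lact b n) >>).

(* The tensor product of M and N over B. *)
Definition btens := presmod btens_rel.
Definition bpure (m : M) (n : N) : btens := pgen btens_rel (m, n).

Definition bcompat (G : lmodType k) (h : M -> N -> G) :=
  [/\ forall n, linear (h^~ n), forall m, linear (h m) &
      forall m b n, h (ract m b) n = h m (lact b n)].

Lemma bcompatP (G : lmodType k) (h : M -> N -> G) :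
  bcompat h -> compatible btens_rel (fun z => h z.1 z.2).
Proof.
move=> [h1 h2 h3] _ [a m m' n|a m n n'|m b n].
- by apply: lift_lin_relator; rewrite /= h1.
- by apply: lift_lin_relator; rewrite /= h2.
- by apply: lift_eq_relator; rewrite /= h3.
Qed.

Lemma bpure_compat : bcompat bpure.
Proof.
split=> [n a m m'|m a n n'|m b n].
- by apply: pgen_lin; exact: BtensL.
- by apply: pgen_lin; exact: BtensR.
- by apply: pgen_eq; exact: BtensM.
Qed.

Lemma sum2_bpure (u : btens) : sum2 bpure u = u.
Proof.
by rewrite -[RHS]psum_pgen; apply: eq_psum => -[m n].
Qed.

Lemma bsum_linear (G : lmodType k) (h : M -> N -> G) :
  bcompat h -> linear (sum2 (rel := btens_rel) h).
Proof. by move=> /bcompatP; apply: psum_linear. Qed.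

Lemma bsumE (G : lmodType k) (h : M -> N -> G) m n :
  bcompat h -> sum2 h (bpure m n) = h m n.
Proof. by move=> /bcompatP c; rewrite /sum2 /bpure psumE. Qed.
End Btens.

(* An R^e-ring: an algebra map r \bar s |-> src r * tgt s from R^e amounts to an
   algebra map src on R and an anti-homomorphism tgt on R with commuting
   images. *)
Record rering (R : algType k) := RERing {
  rering_car :> algType k;
  src : {lrmorphism R -> rering_car};
  tgt : {linear R -> rering_car};
  tgt1 : tgt 1 = 1;
  tgtM : forall r s, tgt (r * s) = tgt s * tgt r;
  src_tgtC : forall r s, src r * tgt s = tgt s * src r }.

Section Diamond.
Context (R : algType k) (A : rering R).

Inductive diamond_rel : {freeg (A * A)%type / k} -> Prop :=
| DiamondL a m m' n : diamond_rel (lin_relator a (a *: m + m', n) (m, n) (m', n))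
| DiamondR a m n n' : diamond_rel (lin_relator a (m, a *: n + n') (m, n) (m, n'))
| DiamondM m r n :
    diamond_rel (<< (tgt A r * m, n) >> - << (m, src A r * n) >>).

(* The tensor product of the R-bimodules A and A: \bar r m (x) n = m (x) r n. *)
Definition diamond := presmod diamond_rel.
Definition dpure (m n : A) : diamond := pgen diamond_rel (m, n).

Definition dcompat (G : lmodType k) (h : A -> A -> G) :=
  [/\ forall n, linear (h^~ n), forall m, linear (h m) &
      forall m r n, h (tgt A r * m) n = h m (src A r * n)].

Lemma dcompatP (G : lmodType k) (h : A -> A -> G) :
  dcompat h -> compatible diamond_rel (fun z => h z.1 z.2).
Proof.
move=> [h1 h2 h3] _ [a m m' n|a m n n'|m b n].
- by apply: lift_lin_relator; rewrite /= h1.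
- by apply: lift_lin_relator; rewrite /= h2.
- by apply: lift_eq_relator; rewrite /= h3.
Qed.

Lemma dpure_compat : dcompat dpure.
Proof.
split=> [n a m m'|m a n n'|m b n].
- by apply: pgen_lin; exact: DiamondL.
- by apply: pgen_lin; exact: DiamondR.
- by apply: pgen_eq; exact: DiamondM.
Qed.

Lemma sum2_dpure (u : diamond) : sum2 dpure u = u.
Proof. by rewrite -[RHS]psum_pgen; apply: eq_psum => -[m n]. Qed.

Lemma dsum_linear (G : lmodType k) (h : A -> A -> G) :
  dcompat h -> linear (sum2 (rel := diamond_rel) h).
Proof. by move=> /dcompatP; apply: psum_linear. Qed.

Lemma dsumE (G : lmodType k) (h : A -> A -> G) m n :
  dcompat h -> sum2 h (dpure m n) = h m n.
Proof. by move=> /dcompatP c; rewrite /sum2 /dpure psumE. Qed.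

Lemma dsum_sum (X Y : choiceType) (rel : {freeg (X * Y) / k} -> Prop)
    (G : lmodType k) (h : A -> A -> G) (f : X -> Y -> diamond) (u : presmod rel) :
  dcompat h -> sum2 h (sum2 f u) = sum2 (fun x y => sum2 h (f x y)) u.
Proof. by move=> c; apply: sum2_comp; apply: dsum_linear. Qed.

Lemma dsum_sum_pure (X Y : choiceType) (rel : {freeg (X * Y) / k} -> Prop)
    (G : lmodType k) (h : A -> A -> G) (f g : X -> Y -> A) (u : presmod rel) :
  dcompat h ->
  sum2 h (sum2 (fun x y => dpure (f x y) (g x y)) u)
  = sum2 (fun x y => h (f x y) (g x y)) u.
Proof.
by move=> c; rewrite dsum_sum //; apply: eq_sum2 => x y; rewrite dsumE.
Qed.

Inductive diamond3_rel : {freeg (A * A * A)%type / k} -> Prop :=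
| Diamond3L a l l' m n :
    diamond3_rel (lin_relator a (a *: l + l', m, n) (l, m, n) (l', m, n))
| Diamond3C a l m m' n :
    diamond3_rel (lin_relator a (l, a *: m + m', n) (l, m, n) (l, m', n))
| Diamond3R a l m n n' :
    diamond3_rel (lin_relator a (l, m, a *: n + n') (l, m, n) (l, m, n'))
| Diamond3M1 l r m n :
    diamond3_rel (<< (tgt A r * l, m, n) >> - << (l, src A r * m, n) >>)
| Diamond3M2 l m r n :
    diamond3_rel (<< (l, tgt A r * m, n) >> - << (l, m, src A r * n) >>).

Definition diamond3 := presmod diamond3_rel.
Definition dpure3 (l m n : A) : diamond3 := pgen diamond3_rel (l, m, n).

Definition sum3 (G : lmodType k) (h : A -> A -> A -> G) (u : diamond3) : G :=
  psum (fun z => h z.1.1 z.1.2 z.2) u.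

Definition d3compat (G : lmodType k) (h : A -> A -> A -> G) :=
  [/\ forall m n, linear (fun l => h l m n), forall l n, linear (fun m => h l m n),
      forall l m, linear (h l m),
      forall r l m n, h (tgt A r * l) m n = h l (src A r * m) n &
      forall r l m n, h l (tgt A r * m) n = h l m (src A r * n)].

Lemma d3compatP (G : lmodType k) (h : A -> A -> A -> G) :
  d3compat h -> compatible diamond3_rel (fun z => h z.1.1 z.1.2 z.2).
Proof.
move=> [h1 h2 h3 h4 h5] _ [a l l' m n|a l m m' n|a l m n n'|l r m n|l m r n].
- by apply: lift_lin_relator; rewrite /= h1.
- by apply: lift_lin_relator; rewrite /= h2.
- by apply: lift_lin_relator; rewrite /= h3.
- by apply: lift_eq_relator; rewrite /= h4.
- by apply: lift_eq_relator; rewrite /= h5.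
Qed.

Lemma dpure3_compat : d3compat dpure3.
Proof.
split=> [m n a l l'|l n a m m'|l m a n n'|r l m n|r l m n].
- by apply: pgen_lin; exact: Diamond3L.
- by apply: pgen_lin; exact: Diamond3C.
- by apply: pgen_lin; exact: Diamond3R.
- by apply: pgen_eq; exact: Diamond3M1.
- by apply: pgen_eq; exact: Diamond3M2.
Qed.

Lemma sum3_linear (G : lmodType k) (h : A -> A -> A -> G) :
  d3compat h -> linear (sum3 h).
Proof. by move=> /d3compatP; apply: psum_linear. Qed.

Lemma sum3E (G : lmodType k) (h : A -> A -> A -> G) l m n :
  d3compat h -> sum3 h (dpure3 l m n) = h l m n.
Proof. by move=> /d3compatP c; rewrite /sum3 /dpure3 psumE. Qed.

Lemma sum3_dpure3 (u : diamond3) : sum3 dpure3 u = u.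
Proof. by rewrite -[RHS]psum_pgen; apply: eq_psum => -[[l m] n]. Qed.

End Diamond.

(* A bialgebra over R in the sense of Takeuchi. The comultiplication cop takes its
   values in the Takeuchi product, the subset of the diamond product cut out by
   the condition cop_takeuchi; on this subset the product of copM is well defined
   (dcompat_mulr). The counit cou is viewed as a map from L to End_k(R). *)
Record xbialgebra (R : algType k) := XBialgebra {
  xring :> rering R;
  cop : xring -> diamond xring;
  cou : xring -> R -> R;
  cop_lin : linear cop;
  cop_src_tgt : forall r s,
    cop (src xring r * tgt xring s) = dpure (src xring r) (tgt xring s);
  cop_takeuchi : forall s x,
    sum2 (fun y z => dpure (y * tgt xring s) z) (cop x) =
    sum2 (fun y z => dpure y (z * src xring s)) (cop x);
  copM : forall x y, cop (x * y) =
    sum2 (fun x1 x2 => sum2 (fun y1 y2 => dpure (x1 * y1) (x2 * y2)) (cop y))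
      (cop x);
  cou_lin : forall r, linear (cou^~ r);
  cou_linr : forall x, linear (cou x);
  cou_src_tgt : forall r s t, cou (src xring r * tgt xring s) t = r * t * s;
  couM : forall x y r, cou (x * y) r = cou x (cou y r);
  copA : forall x,
    sum2 (fun x1 x2 => sum2 (fun y z => dpure3 y z x2) (cop x1)) (cop x) =
    sum2 (fun x1 x2 => sum2 (fun y z => dpure3 x1 y z) (cop x2)) (cop x);
  counitl : forall x,
    sum2 (fun x1 x2 => tgt xring (cou x2 1) * x1) (cop x) = x;
  counitr : forall x,
    sum2 (fun x1 x2 => src xring (cou x1 1) * x2) (cop x) = x }.

(* An isomorphism of R^e-rings compatible with comultiplication and counit. *)
Definition xiso (R : algType k) (A B : xbialgebra R) :=
  exists phi : {lrmorphism A -> B},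
    [/\ bijective phi,
        forall r, phi (src A r) = src B r,
        forall r, phi (tgt A r) = tgt B r,
        forall x, cop (phi x) = sum2 (fun y z => dpure (phi y) (phi z)) (cop x) &
        forall x, cou (phi x) = cou x].

End Basics.

Lemma mul_linl (k : comNzRingType) (A : algType k) (y : A) : linear (fun x => x * y).
Proof. by move=> a u v; rewrite mulrDl scalerAl. Qed.
Lemma mul_linr (k : comNzRingType) (A : algType k) (x : A) : linear (fun y => x * y).
Proof. by move=> a u v; rewrite mulrDr scalerAr. Qed.
Lemma lin_comp (k : comNzRingType) (U V W : lmodType k) (f : V -> W) (g : U -> V) :
  linear f -> linear g -> linear (fun x => f (g x)).
Proof. by move=> lf lg a x y; rewrite lg lf. Qed.


Section ReTheory.
Context (k : comNzRingType) (R : algType k) (A : rering R).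

(* The image of r \bar s in A. *)
Definition eact (r s : R) : A := src A r * tgt A s.

Lemma eactM r s r' s' : eact r s * eact r' s' = eact (r * r') (s' * s).
Proof.
by rewrite /eact rmorphM tgtM !mulrA -[_ * tgt A s * _]mulrA -src_tgtC !mulrA.
Qed.
Lemma eact11 : eact 1 1 = 1.
Proof. by rewrite /eact rmorph1 tgt1 mulr1. Qed.
Lemma eactr1 r : eact r 1 = src A r.
Proof. by rewrite /eact tgt1 mulr1. Qed.
Lemma eact1r r : eact 1 r = tgt A r.
Proof. by rewrite /eact rmorph1 mul1r. Qed.
Lemma eact_linl s : linear (eact^~ s).
Proof. by move=> a x y; rewrite /eact linearP mul_linl. Qed.
Lemma eact_linr r : linear (eact r).
Proof. by move=> a x y; rewrite /eact linearP mul_linr. Qed.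
End ReTheory.

Section DcompatTheory.
Context (k : comNzRingType) (R : algType k) (A : rering R) (G : lmodType k).
Implicit Types (h : A -> A -> G) (r s : R).

Lemma dcompat_mull h y1 y2 : dcompat h ->
  dcompat (fun x1 x2 => h (x1 * y1) (x2 * y2)).
Proof.
move=> [h1 h2 h3]; split=> [n a m m'|m a n n'|m r n].
- by rewrite mul_linl h1.
- by rewrite mul_linl h2.
- by rewrite -!mulrA h3.
Qed.

Lemma dcompat_sum (X Y : choiceType) (rel : {freeg (X * Y) / k} -> Prop)
  (h : X -> Y -> A -> A -> G) (u : presmod rel) :
  (forall (x : X) (y : Y), dcompat (h x y)) ->
  dcompat (fun m n => sum2 (fun (x : X) (y : Y) => h x y m n) u).
Proof.
move=> c; split=> [n a m m'|m a n n'|m r n].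
- by apply: sum2_linP => x y; have [-> _ _] := c x y.
- by apply: sum2_linP => x y; have [_ -> _] := c x y.
- by apply: eq_sum2 => x y; have [_ _ ->] := c x y.
Qed.

(* Componentwise left multiplication by an element of the Takeuchi product. *)
Lemma dcompat_mulr h (u : diamond A) : dcompat h ->
  (forall s, sum2 (fun y z => dpure (y * tgt A s) z) u =
             sum2 (fun y z => dpure y (z * src A s)) u) ->
  dcompat (fun y1 y2 => sum2 (fun x1 x2 => h (x1 * y1) (x2 * y2)) u).
Proof.
move=> c T; have [h1 h2 h3] := c; split=> [n a m m'|m a n n'|m r n].
- by apply: sum2_linP => ? ?; rewrite mul_linr h1.
- by apply: sum2_linP => ? ?; rewrite mul_linr h2.
- under eq_sum2 => ? ? do rewrite mulrA.
  have := congr1 (sum2 (fun u v => h (u * m) (v * n))) (T r).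
  have cm := dcompat_mull m n c.
  rewrite !dsum_sum_pure // => ->.
  by apply: eq_sum2 => ? ?; rewrite !mulrA.
Qed.

End DcompatTheory.

Section BialgTheory.
Context (k : comNzRingType) (R : algType k) (L : xbialgebra R).
Context (G : lmodType k).
Implicit Types (h : L -> L -> G) (x y : L) (r s : R).

Lemma cop_takeuchiK h s x : dcompat h ->
  sum2 (fun y z => h (y * tgt L s) z) (cop x) =
  sum2 (fun y z => h y (z * src L s)) (cop x).
Proof.
move=> c; have := congr1 (sum2 h) (cop_takeuchi s x).
by rewrite !dsum_sum_pure.
Qed.

Lemma copMK h x y : dcompat h -> sum2 h (cop (x * y)) =
  sum2 (fun x1 x2 => sum2 (fun y1 y2 => h (x1 * y1) (x2 * y2)) (cop y)) (cop x).
Proof.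
move=> c; rewrite copM dsum_sum //.
by apply: eq_sum2 => u v; rewrite dsum_sum_pure.
Qed.

Lemma copAK (h : L -> L -> L -> G) x : d3compat h ->
  sum2 (fun x1 x2 => sum2 (fun y z => h y z x2) (cop x1)) (cop x) =
  sum2 (fun x1 x2 => sum2 (fun y z => h x1 y z) (cop x2)) (cop x).
Proof.
move=> c; have := congr1 (sum3 h) (copA x).
have l := sum3_linear c.
rewrite !(sum2_comp _ _ l).
under eq_sum2 => u v.
  rewrite (sum2_comp _ _ l).
  under eq_sum2 => ? ? do rewrite sum3E //.
  over.
move->; apply: eq_sum2 => u v.
rewrite (sum2_comp _ _ l); apply: eq_sum2 => ? ?; by rewrite sum3E.
Qed.

Lemma cop_eactl h r s x : dcompat h -> sum2 h (cop (eact L r s * x)) =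
  sum2 (fun y z => h (src L r * y) (tgt L s * z)) (cop x).
Proof.
move=> c; rewrite copMK // /eact cop_src_tgt dsumE //.
by apply: (@dcompat_sum _ _ _ _ _ _ _ (fun y1 y2 x1 x2 => h (x1 * y1) (x2 * y2))) => *;
  apply: dcompat_mull.
Qed.

Lemma cop_eactr h r s x : dcompat h -> sum2 h (cop (x * eact L r s)) =
  sum2 (fun y z => h (y * src L r) (z * tgt L s)) (cop x).
Proof.
move=> c; rewrite copMK // sum2_swap /eact cop_src_tgt dsumE //.
by apply: dcompat_mulr => // t; apply: cop_takeuchi.
Qed.

Lemma sum2_cop_linear h : dcompat h -> linear (fun x => sum2 h (cop x)).
Proof. by move=> c; apply: lin_comp (dsum_linear c) (@cop_lin _ _ L). Qed.

End BialgTheory.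

Section CouTheory.
Context (k : comNzRingType) (R : algType k) (L : xbialgebra R).
Lemma cou1 r : cou (1 : L) r = r.
Proof. by have := @cou_src_tgt _ _ L 1 1 r; rewrite -/(eact _ 1 1) eact11 mul1r mulr1. Qed.
Lemma cou_eact r s t : cou (eact L r s) t = r * t * s.
Proof. exact: cou_src_tgt. Qed.
End CouTheory.

(* A strict Morita context; its two maps are isomorphisms of bimodules with
   inverses mfV and mgV. *)
Record morita_context (k : comNzRingType) (R S : algType k) := MoritaContext {
  mP : bimod S R;
  mQ : bimod R S;
  mf : btens mP mQ -> S;
  mg : btens mQ mP -> R;
  mfV : S -> btens mP mQ;
  mgV : R -> btens mQ mP;
  mf_lin : linear mf;
  mg_lin : linear mg;
  mf_bimod : forall s p q t,
    mf (bpure (lact s p) (ract q t)) = s * mf (bpure p q) * t;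
  mg_bimod : forall r q p t,
    mg (bpure (lact r q) (ract p t)) = r * mg (bpure q p) * t;
  mfK : cancel mf mfV;
  mfVK : cancel mfV mf;
  mgK : cancel mg mgV;
  mgVK : cancel mgV mg;
  mfgA : forall p q p',
    lact (mf (bpure p q)) p' = ract p (mg (bpure q p'));
  mgfA : forall q p q',
    lact (mg (bpure q p)) q' = ract q (mf (bpure p q')) }.

Section MoritaTheory.
Context (k : comNzRingType) (R S : algType k) (C : morita_context R S).
Local Notation P := (mP C).
Local Notation Q := (mQ C).

Definition pq (p : P) (q : Q) : S := mf (bpure p q).
Definition qp (q : Q) (p : P) : R := mg (bpure q p).

(* The inverse images of 1. *)
Definition fV : btens P Q := mfV C 1.
Definition gV : btens Q P := mgV C 1.

Lemma pq_linl q : linear (pq^~ q).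
Proof. by have [h _ _] := bpure_compat P Q; move=> a x y; rewrite /pq h mf_lin. Qed.
Lemma pq_linr p : linear (pq p).
Proof. by have [_ h _] := bpure_compat P Q; move=> a x y; rewrite /pq h mf_lin. Qed.
Lemma qp_linl p : linear (qp^~ p).
Proof. by have [h _ _] := bpure_compat Q P; move=> a x y; rewrite /qp h mg_lin. Qed.
Lemma qp_linr q : linear (qp q).
Proof. by have [_ h _] := bpure_compat Q P; move=> a x y; rewrite /qp h mg_lin. Qed.
Lemma pq_bal p r q : pq (ract p r) q = pq p (lact r q).
Proof. by have [_ _ h] := bpure_compat P Q; rewrite /pq h. Qed.
Lemma qp_bal q s p : qp (ract q s) p = qp q (lact s p).
Proof. by have [_ _ h] := bpure_compat Q P; rewrite /qp h. Qed.
Lemma pqMl s p q : pq (lact s p) q = s * pq p q.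
Proof. by have := mf_bimod s p q (1 : S); rewrite ract1 mulr1. Qed.
Lemma pqMr p q s : pq p (ract q s) = pq p q * s.
Proof. by have := mf_bimod (1 : S) p q s; rewrite lact1 mul1r. Qed.
Lemma qpMl r q p : qp (lact r q) p = r * qp q p.
Proof. by have := mg_bimod r q p (1 : R); rewrite ract1 mulr1. Qed.
Lemma qpMr q p r : qp q (ract p r) = qp q p * r.
Proof. by have := mg_bimod (1 : R) q p r; rewrite lact1 mul1r. Qed.
Lemma pqA p q p' : lact (pq p q) p' = ract p (qp q p').
Proof. exact: mfgA. Qed.
Lemma qpA q p q' : lact (qp q p) q' = ract q (pq p q').
Proof. exact: mgfA. Qed.

Lemma sum_fV : sum2 pq fV = 1.
Proof.
rewrite -[RHS](mfVK C 1) -/fV -[in RHS](sum2_bpure fV) (sum2_comp _ _ (@mf_lin _ _ _ C)).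
by [].
Qed.
Lemma sum_gV : sum2 qp gV = 1.
Proof.
rewrite -[RHS](mgVK C 1) -/gV -[in RHS](sum2_bpure gV) (sum2_comp _ _ (@mg_lin _ _ _ C)).
by [].
Qed.

Lemma fV_P p : sum2 (fun pi qi => ract pi (qp qi p)) fV = p.
Proof.
under eq_sum2 => ? ? do rewrite -pqA.
by rewrite -[RHS]lact1 -sum_fV (sum2_comp _ _ (lact_linl p)).
Qed.
Lemma fV_Q q : sum2 (fun pi qi => lact (qp q pi) qi) fV = q.
Proof.
under eq_sum2 => ? ? do rewrite qpA.
by rewrite -[RHS]ract1 -sum_fV (sum2_comp _ _ (ract_linr q)).
Qed.
Lemma gV_Q q : sum2 (fun qi pi => ract qi (pq pi q)) gV = q.
Proof.
under eq_sum2 => ? ? do rewrite -qpA.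
by rewrite -[RHS]lact1 -sum_gV (sum2_comp _ _ (lact_linl q)).
Qed.
Lemma gV_P p : sum2 (fun qi pi => lact (pq p qi) pi) gV = p.
Proof.
under eq_sum2 => ? ? do rewrite pqA.
by rewrite -[RHS]ract1 -sum_gV (sum2_comp _ _ (ract_linr p)).
Qed.

Lemma gV_central (G : lmodType k) (h : Q -> P -> G) r : bcompat h ->
  sum2 (fun qi pi => h (lact r qi) pi) gV = sum2 (fun qi pi => h qi (ract pi r)) gV.
Proof.
move=> c.
have E : sum2 (fun qi pi => bpure (lact r qi) pi) gV =
         sum2 (fun qi pi => bpure qi (ract pi r)) gV.
  apply: (can_inj (@mgK _ _ _ C)).
  rewrite !(sum2_comp _ _ (@mg_lin _ _ _ C)).
  under eq_sum2 => ? ? do rewrite -/(qp _ _) qpMl.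
  under [in RHS]eq_sum2 => ? ? do rewrite -/(qp _ _) qpMr.
  rewrite -(sum2_comp _ _ (mul_linr r)) -(sum2_comp _ _ (mul_linl r)).
  by rewrite !sum_gV mulr1 mul1r.
have := congr1 (sum2 h) E; rewrite !(sum2_comp _ _ (bsum_linear c)).
under eq_sum2 => ? ? do rewrite bsumE //.
by move->; apply: eq_sum2 => ? ?; rewrite bsumE.
Qed.

End MoritaTheory.

Section BaseChange.
Context (k : comNzRingType) (R S : algType k) (C : morita_context R S).
Context (L : xbialgebra R).
Local Notation P := (mP C).
Local Notation Q := (mQ C).

(* Relators presenting the iterated tensor product of P^e, L and Q^e over R^e;
   (p, q, l, q', p') stands for p \bar q (x) l (x) q' \bar p'. *)
Inductive bct_rel : {freeg (P * Q * L * Q * P)%type / k} -> Prop :=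
| BctP a p p' q l q1 p1 :
    bct_rel (lin_relator a (a *: p + p', q, l, q1, p1) (p, q, l, q1, p1)
                           (p', q, l, q1, p1))
| BctQ a p q q' l q1 p1 :
    bct_rel (lin_relator a (p, a *: q + q', l, q1, p1) (p, q, l, q1, p1)
                           (p, q', l, q1, p1))
| BctL a p q l l' q1 p1 :
    bct_rel (lin_relator a (p, q, a *: l + l', q1, p1) (p, q, l, q1, p1)
                           (p, q, l', q1, p1))
| BctQ1 a p q l q1 q1' p1 :
    bct_rel (lin_relator a (p, q, l, a *: q1 + q1', p1) (p, q, l, q1, p1)
                           (p, q, l, q1', p1))
| BctP1 a p q l q1 p1 p1' :
    bct_rel (lin_relator a (p, q, l, q1, a *: p1 + p1') (p, q, l, q1, p1)
                           (p, q, l, q1, p1'))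
| BctMl p q r s l q1 p1 :
    bct_rel (<< (ract p r, lact s q, l, q1, p1) >>
             - << (p, q, eact L r s * l, q1, p1) >>)
| BctMr p q l r s q1 p1 :
    bct_rel (<< (p, q, l * eact L r s, q1, p1) >>
             - << (p, q, l, lact r q1, ract p1 s) >>).

Definition bct := presmod bct_rel.
HB.instance Definition _ := GRing.Lmodule.on bct.

Definition bpt (p : P) (q : Q) (l : L) (q1 : Q) (p1 : P) : bct :=
  pgen bct_rel (p, q, l, q1, p1).

Definition bsum (G : lmodType k) (h : P -> Q -> L -> Q -> P -> G) (u : bct) : G :=
  psum (fun z : P * Q * L * Q * P => let: (p, q, l, q1, p1) := z in h p q l q1 p1) u.

Record ccompat (G : lmodType k) (h : P -> Q -> L -> Q -> P -> G) : Prop := CCompat {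
  ccP : forall q l q1 p1, linear (fun p => h p q l q1 p1);
  ccQ : forall p l q1 p1, linear (fun q => h p q l q1 p1);
  ccL : forall p q q1 p1, linear (fun l => h p q l q1 p1);
  ccQ1 : forall p q l p1, linear (fun q1 => h p q l q1 p1);
  ccP1 : forall p q l q1, linear (fun p1 => h p q l q1 p1);
  ccMl : forall p q r s l q1 p1,
    h (ract p r) (lact s q) l q1 p1 = h p q (eact L r s * l) q1 p1;
  ccMr : forall p q l r s q1 p1,
    h p q (l * eact L r s) q1 p1 = h p q l (lact r q1) (ract p1 s) }.

Lemma ccompatP (G : lmodType k) (h : P -> Q -> L -> Q -> P -> G) :
  ccompat h ->
  compatible bct_rel (fun z : P * Q * L * Q * P =>
    let: (p, q, l, q1, p1) := z in h p q l q1 p1).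
Proof.
move=> c _ [a p p' q l q1 p1|a p q q' l q1 p1|a p q l l' q1 p1
  |a p q l q1 q1' p1|a p q l q1 p1 p1'|p q r s l q1 p1|p q l r s q1 p1].
- by apply: lift_lin_relator; apply: (ccP c).
- by apply: lift_lin_relator; apply: (ccQ c).
- by apply: lift_lin_relator; apply: (ccL c).
- by apply: lift_lin_relator; apply: (ccQ1 c).
- by apply: lift_lin_relator; apply: (ccP1 c).
- by apply: lift_eq_relator; apply: (ccMl c).
- by apply: lift_eq_relator; apply: (ccMr c).
Qed.

Lemma bpt_compat : ccompat bpt.
Proof.
split=> [q l q1 p1 a p p'|p l q1 p1 a q q'|p q q1 p1 a l l'|p q l p1 a q1 q1'
  |p q l q1 a p1 p1'|p q r s l q1 p1|p q l r s q1 p1].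
- by apply: pgen_lin; exact: BctP.
- by apply: pgen_lin; exact: BctQ.
- by apply: pgen_lin; exact: BctL.
- by apply: pgen_lin; exact: BctQ1.
- by apply: pgen_lin; exact: BctP1.
- by apply: pgen_eq; exact: BctMl.
- by apply: pgen_eq; exact: BctMr.
Qed.

Lemma bsum_lin (G : lmodType k) (h : P -> Q -> L -> Q -> P -> G) :
  ccompat h -> linear (bsum h).
Proof. by move=> /ccompatP; apply: psum_linear. Qed.

Lemma bsum_pt (G : lmodType k) (h : P -> Q -> L -> Q -> P -> G) p q l q1 p1 :
  ccompat h -> bsum h (bpt p q l q1 p1) = h p q l q1 p1.
Proof. by move=> /ccompatP c; rewrite /bsum /bpt psumE. Qed.

Lemma bct_ext (G : lmodType k) (F F' : bct -> G) : linear F -> linear F' ->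
  (forall p q l q1 p1, F (bpt p q l q1 p1) = F' (bpt p q l q1 p1)) -> F =1 F'.
Proof.
by move=> lF lF' H; apply: linear_pres_ext => // -[[[[p q] l] q1] p1]; apply: H.
Qed.

Lemma bsum_linP (G : lmodType k) (h h1 h2 : P -> Q -> L -> Q -> P -> G) a u :
  (forall p q l q1 p1, h p q l q1 p1 = a *: h1 p q l q1 p1 + h2 p q l q1 p1) ->
  bsum h u = a *: bsum h1 u + bsum h2 u.
Proof. by move=> H; apply: psum_linP => -[[[[p q] l] q1] p1]; apply: H. Qed.

Lemma eq_bsum (G : lmodType k) (h h' : P -> Q -> L -> Q -> P -> G) u :
  (forall p q l q1 p1, h p q l q1 p1 = h' p q l q1 p1) -> bsum h u = bsum h' u.
Proof. by move=> H; apply: eq_psum => -[[[[p q] l] q1] p1]; apply: H. Qed.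

Definition bmul (u v : bct) : bct :=
  bsum (fun p1 q1 l q2 p2 => bsum (fun p3 q3 m q4 p4 =>
    bpt p1 q1 (l * src L (qp q2 p3) * tgt L (qp q3 p2) * m) q4 p4) v) u.

Let body p1 q1 (l : L) (q2 : Q) (p2 : P) p3 q3 m q4 p4 :=
  bpt p1 q1 (l * src L (qp q2 p3) * tgt L (qp q3 p2) * m) q4 p4.
Let bodyE p1 q1 l q2 p2 p3 q3 m q4 p4 : body p1 q1 l q2 p2 p3 q3 m q4 p4 =
  bpt p1 q1 (l * eact L (qp q2 p3) (qp q3 p2) * m) q4 p4.
Proof. by rewrite /body /eact !mulrA. Qed.

Let body_compat p1 q1 l q2 p2 : ccompat (body p1 q1 l q2 p2).
Proof.
have [bP bQ bL bQ1 bP1 bMl bMr] := bpt_compat.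
split; ia; rewrite !bodyE.
- by rewrite qp_linr eact_linl mul_linr mul_linl bL.
- by rewrite qp_linl eact_linr mul_linr mul_linl bL.
- by rewrite mul_linr bL.
- by rewrite bQ1.
- by rewrite bP1.
- by rewrite qpMr qpMl -eactM !mulrA.
- by rewrite mulrA bMr.
Qed.

Let body_compat2 v : ccompat (fun p1 q1 l q2 p2 => bsum (body p1 q1 l q2 p2) v).
Proof.
have [bP bQ bL bQ1 bP1 bMl bMr] := bpt_compat.
split; ia.
- by apply: bsum_linP => *; rewrite !bodyE bP.
- by apply: bsum_linP => *; rewrite !bodyE bQ.
- by apply: bsum_linP => *; rewrite !bodyE !mul_linl bL.
- by apply: bsum_linP => *; rewrite !bodyE qp_linl eact_linl mul_linr mul_linl bL.
- by apply: bsum_linP => *; rewrite !bodyE qp_linr eact_linr mul_linr mul_linl bL.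
- by apply: eq_bsum => *; rewrite !bodyE bMl !mulrA.
- by apply: eq_bsum => *; rewrite !bodyE qpMl qpMr -eactM !mulrA.
Qed.

Lemma bmul_linl v : linear (bmul^~ v).
Proof. exact: bsum_lin (body_compat2 v). Qed.
Lemma bmul_linr u : linear (bmul u).
Proof. by move=> a v w; apply: bsum_linP => *; apply: bsum_lin (body_compat _ _ _ _ _) _ _ _. Qed.
Lemma bmul_pt p1 q1 l q2 p2 p3 q3 m q4 p4 :
  bmul (bpt p1 q1 l q2 p2) (bpt p3 q3 m q4 p4) =
  bpt p1 q1 (l * eact L (qp q2 p3) (qp q3 p2) * m) q4 p4.
Proof.
rewrite /bmul (bsum_pt _ _ _ _ _ (body_compat2 _)) (bsum_pt _ _ _ _ _ (body_compat _ _ _ _ _)).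
exact: bodyE.
Qed.

Lemma bmulA : associative bmul.
Proof.
move=> u v w; move: u; apply: bct_ext => [||p1 q1 l q2 p2].
- exact: bmul_linl.
- by apply: lin_comp; apply: bmul_linl.
move: v; apply: bct_ext => [||p3 q3 m q4 p4].
- by apply: lin_comp; [apply: bmul_linr | apply: bmul_linl].
- by apply: lin_comp; [apply: bmul_linl | apply: bmul_linr].
move: w; apply: bct_ext => [||p5 q5 n q6 p6].
- by apply: lin_comp; apply: bmul_linr.
- exact: bmul_linr.
by rewrite !bmul_pt !mulrA.
Qed.

Lemma bmulDl : left_distributive bmul +%R.
Proof. by move=> u v w; rewrite (linfD (bmul_linl w)). Qed.
Lemma bmulDr : right_distributive bmul +%R.
Proof. by move=> u v w; rewrite (linfD (bmul_linr u)). Qed.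

(* The image of s \bar t in the base change. *)
Definition beact (s t : S) : bct :=
  sum2 (fun pi qi => sum2 (fun pj qj =>
    bpt (lact s pi) (ract qj t) 1 qi pj) (fV C)) (fV C).

Lemma beact_linl t : linear (beact^~ t).
Proof.
have [bP bQ bL bQ1 bP1 bMl bMr] := bpt_compat.
by move=> a x y; do 2![apply: sum2_linP => *]; rewrite lact_linl bP.
Qed.
Lemma beact_linr s : linear (beact s).
Proof.
have [bP bQ bL bQ1 bP1 bMl bMr] := bpt_compat.
by move=> a x y; do 2![apply: sum2_linP => *]; rewrite ract_linr bQ.
Qed.

Lemma beact_pt s t p q l q1 p1 :
  bmul (beact s t) (bpt p q l q1 p1) = bpt (lact s p) (ract q t) l q1 p1.
Proof.
have [bP bQ bL bQ1 bP1 bMl bMr] := bpt_compat.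
rewrite /beact (sum2_comp _ _ (bmul_linl _)).
under eq_sum2 => pi qi.
  rewrite (sum2_comp _ _ (bmul_linl _)).
  under eq_sum2 => pj qj do rewrite bmul_pt mul1r -bMl lractA.
  rewrite -(sum2_comp _ _ (bQ _ _ _ _)).
  under eq_sum2 => pj qj do rewrite -lractA.
  rewrite -(sum2_comp _ _ (ract_lin _)) fV_Q.
  over.
by rewrite -(sum2_comp _ _ (bP _ _ _ _)) -(sum2_comp _ _ (lact_lin _)) fV_P.
Qed.

Lemma pt_beact s t p q l q1 p1 :
  bmul (bpt p q l q1 p1) (beact s t) = bpt p q l (ract q1 s) (lact t p1).
Proof.
have [bP bQ bL bQ1 bP1 bMl bMr] := bpt_compat.
rewrite /beact (sum2_comp _ _ (bmul_linr _)).
under eq_sum2 => pi qi.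
  rewrite (sum2_comp _ _ (bmul_linr _)).
  under eq_sum2 => pj qj do rewrite bmul_pt mulr1 bMr -qp_bal qp_bal.
  rewrite -(sum2_comp _ _ (bP1 _ _ _ _)).
  under eq_sum2 => pj qj do rewrite qp_bal.
  rewrite fV_P.
  over.
rewrite -(sum2_comp _ _ (bQ1 _ _ _ _)).
by under eq_sum2 => pi qi do rewrite -qp_bal; rewrite fV_Q.
Qed.

Lemma beactM s t s' t' : bmul (beact s t) (beact s' t') = beact (s * s') (t' * t).
Proof.
rewrite {2}/beact (sum2_comp _ _ (bmul_linr _)); apply: eq_sum2 => pi qi.
rewrite (sum2_comp _ _ (bmul_linr _)); apply: eq_sum2 => pj qj.
by rewrite beact_pt lactM ractM.
Qed.

Lemma bmul1l : left_id (beact 1 1) bmul.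
Proof.
move=> u; move: u; apply: bct_ext => [||p q l q1 p1]; first exact: bmul_linr.
  by [].
by rewrite beact_pt lact1 ract1.
Qed.
Lemma bmul1r : right_id (beact 1 1) bmul.
Proof.
move=> u; move: u; apply: bct_ext => [||p q l q1 p1]; first exact: bmul_linl.
  by [].
by rewrite pt_beact lact1 ract1.
Qed.

Definition bcou (u : bct) (s : S) : S :=
  bsum (fun p1 q1 l q2 p2 => pq (ract p1 (cou l (qp (ract q2 s) p2))) q1) u.

Let cou_eactl r s (x : L) t : cou (eact L r s * x) t = r * cou x t * s.
Proof. by rewrite couM cou_eact. Qed.
Let cou_eactr r s (x : L) t : cou (x * eact L r s) t = cou x (r * t * s).
Proof. by rewrite couM cou_eact. Qed.

Lemma bcou_compat s : ccompat (fun p1 q1 (l : L) q2 p2 =>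
  pq (ract p1 (cou l (qp (ract q2 s) p2))) q1).
Proof.
split; ia.
- by rewrite ract_lin pq_linl.
- by rewrite pq_linr.
- by rewrite cou_lin ract_linr pq_linl.
- by rewrite ract_lin qp_linl cou_linr ract_linr pq_linl.
- by rewrite qp_linr cou_linr ract_linr pq_linl.
- by rewrite cou_eactl !ractM -!pq_bal.
- by rewrite cou_eactr lractA qpMl qpMr mulrA.
Qed.
Lemma bcou_lin s : linear (bcou^~ s).
Proof. exact: bsum_lin (bcou_compat s). Qed.
Lemma bcou_linr u : linear (bcou u).
Proof.
by move=> a s t; apply: bsum_linP => *; rewrite ract_linr qp_linl cou_linr ract_linr pq_linl.
Qed.
Lemma bcou_pt p1 q1 l q2 p2 s : bcou (bpt p1 q1 l q2 p2) s =
  pq (ract p1 (cou l (qp (ract q2 s) p2))) q1.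
Proof. by rewrite /bcou bsum_pt //; apply: bcou_compat. Qed.

Lemma bcou_beact s t x : bcou (beact s t) x = s * x * t.
Proof.
rewrite /beact (sum2_comp _ _ (bcou_lin _)).
under eq_sum2 => pi qi.
  rewrite (sum2_comp _ _ (bcou_lin _)).
  under eq_sum2 => pj qj.
    rewrite bcou_pt cou1 pqMr lractA qp_bal -pqA !pqMl !mulrA.
    over.
  rewrite -(sum2_comp _ _ (mul_linl t)) -(sum2_comp _ _ (mul_linr _)) sum_fV mulr1.
  over.
rewrite -(sum2_comp _ _ (mul_linl t)) -(sum2_comp _ _ (mul_linl x)).
by rewrite -(sum2_comp _ _ (mul_linr s)) sum_fV mulr1.
Qed.

Lemma bone_neq0 : beact 1 1 != 0.
Proof.
apply/eqP=> E; have := bcou_beact 1 1 1.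
by rewrite E (linf0 (bcou_lin _)) !mulr1 => /esym/eqP; rewrite oner_eq0.
Qed.

HB.instance Definition _ := GRing.Zmodule_isNzRing.Build bct
  bmulA bmul1l bmul1r bmulDl bmulDr bone_neq0.

Lemma bct_scaleAl a (u v : bct) : a *: (u * v) = (a *: u) * v.
Proof. by rewrite [LHS](esym (linfZ (bmul_linl v) _ _)). Qed.
Lemma bct_scaleAr a (u v : bct) : a *: (u * v) = u * (a *: v).
Proof. by rewrite [LHS](esym (linfZ (bmul_linr u) _ _)). Qed.
HB.instance Definition _ := GRing.Lmodule_isLalgebra.Build k bct bct_scaleAl.
HB.instance Definition _ := GRing.Lalgebra_isAlgebra.Build k bct bct_scaleAr.

Definition bsrc (s : S) : bct := beact s 1.
Definition btgt (t : S) : bct := beact 1 t.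

HB.instance Definition _ := GRing.isLinear.Build k S bct _ bsrc (beact_linl 1).
Lemma bsrc_monoid : monoid_morphism bsrc.
Proof. by split=> // s t; rewrite [RHS]beactM mulr1. Qed.
HB.instance Definition _ := GRing.isMonoidMorphism.Build S bct bsrc bsrc_monoid.
HB.instance Definition _ := GRing.isLinear.Build k S bct _ btgt (beact_linr 1).

Lemma btgtM s t : btgt (s * t) = btgt t * btgt s.
Proof. by rewrite [RHS]beactM mulr1. Qed.
Lemma bsrc_tgtC s t : bsrc s * btgt t = btgt t * bsrc s.
Proof. by rewrite [LHS]beactM [RHS]beactM !mul1r !mulr1. Qed.

Definition base_change_ring : rering S :=
  @RERing _ _ bct bsrc btgt (erefl _) btgtM bsrc_tgtC.

End BaseChange.

Section BaseChangeCop.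
Context (k : comNzRingType) (R S : algType k) (C : morita_context R S).
Context (L : xbialgebra R).
Local Notation P := (mP C).
Local Notation Q := (mQ C).
Local Notation B := (base_change_ring C L).
Local Notation bpt := (@bpt k R S C L).

Lemma fV_central (G : lmodType k) (h : P -> Q -> G) s : bcompat h ->
  sum2 (fun pi qi => h (lact s pi) qi) (fV C) =
  sum2 (fun pi qi => h pi (ract qi s)) (fV C).
Proof.
move=> c.
have E : sum2 (fun pi qi => bpure (lact s pi) qi) (fV C) =
         sum2 (fun pi qi => bpure pi (ract qi s)) (fV C).
  apply: (can_inj (@mfK _ _ _ C)).
  rewrite !(sum2_comp _ _ (@mf_lin _ _ _ C)).
  under eq_sum2 => ? ? do rewrite -/(pq _ _) pqMl.
  under [in RHS]eq_sum2 => ? ? do rewrite -/(pq _ _) pqMr.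
  rewrite -(sum2_comp _ _ (mul_linr s)) -(sum2_comp _ _ (mul_linl s)).
  by rewrite !sum_fV mulr1 mul1r.
have := congr1 (sum2 h) E; rewrite !(sum2_comp _ _ (bsum_linear c)).
under eq_sum2 => ? ? do rewrite bsumE //.
by move->; apply: eq_sum2 => ? ?; rewrite bsumE.
Qed.

Lemma bpt_srcl p r q l q1 p1 : bpt (ract p r) q l q1 p1 = bpt p q (src L r * l) q1 p1.
Proof.
by have [_ _ _ _ _ H _] := bpt_compat C L; rewrite -[q in LHS]lact1 H eactr1.
Qed.
Lemma bpt_tgtl p r q l q1 p1 : bpt p (lact r q) l q1 p1 = bpt p q (tgt L r * l) q1 p1.
Proof.
by have [_ _ _ _ _ H _] := bpt_compat C L; rewrite -[p in LHS]ract1 H eact1r.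
Qed.
Lemma bpt_srcr p r q l q1 p1 : bpt p q (l * src L r) q1 p1 = bpt p q l (lact r q1) p1.
Proof.
by have [_ _ _ _ _ _ H] := bpt_compat C L; rewrite -eactr1 H ract1.
Qed.
Lemma bpt_tgtr p r q l q1 p1 : bpt p q (l * tgt L r) q1 p1 = bpt p q l q1 (ract p1 r).
Proof.
by have [_ _ _ _ _ _ H] := bpt_compat C L; rewrite -eact1r H lact1.
Qed.
Lemma src_bpt s p q l q1 p1 : src B s * (bpt p q l q1 p1 : B) = bpt (lact s p) q l q1 p1.
Proof. by rewrite [LHS]beact_pt ract1. Qed.
Lemma tgt_bpt s p q l q1 p1 : tgt B s * (bpt p q l q1 p1 : B) = bpt p (ract q s) l q1 p1.
Proof. by rewrite [LHS]beact_pt lact1. Qed.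
Lemma bpt_src s p q l q1 p1 : (bpt p q l q1 p1 : B) * src B s = bpt p q l (ract q1 s) p1.
Proof. by rewrite [LHS]pt_beact lact1. Qed.
Lemma bpt_tgt s p q l q1 p1 : (bpt p q l q1 p1 : B) * tgt B s = bpt p q l q1 (lact s p1).
Proof. by rewrite [LHS]pt_beact ract1. Qed.

Lemma B_bmul_pt p1 q1 l q2 p2 p3 q3 m q4 p4 :
  (bpt p1 q1 l q2 p2 : B) * (bpt p3 q3 m q4 p4 : B) =
  bpt p1 q1 (l * eact L (qp q2 p3) (qp q3 p2) * m) q4 p4.
Proof. exact: bmul_pt. Qed.

Section D0.
Context (G : lmodType k).
Implicit Type h : B -> B -> G.

Definition D0 h p1 q1 q2 p2 pj qj (l1 l2 : L) : G :=
  sum2 (fun qi pi => h (bpt p1 qi l1 q2 pj) (bpt pi q1 l2 qj p2)) (gV C).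

Lemma D0_compat h p1 q1 q2 p2 pj qj : dcompat h ->
  dcompat (D0 h p1 q1 q2 p2 pj qj).
Proof.
have [bP bQ bL bQ1 bP1 bMl bMr] := bpt_compat C L.
move=> [h1 h2 h3]; split=> [n a m m'|m a n n'|m r n].
- by apply: sum2_linP => ? ?; rewrite bL h1.
- by apply: sum2_linP => ? ?; rewrite bL h2.
- rewrite /D0.
  under eq_sum2 => ? ? do rewrite -bpt_tgtl.
  under [in RHS]eq_sum2 => ? ? do rewrite -bpt_srcl.
  apply: (gV_central (h := fun qi pi => h (bpt p1 qi m q2 pj) (bpt pi q1 n qj p2))).
  split; ia.
  + by rewrite bQ h1.
  + by rewrite bP h2.
  + by rewrite -tgt_bpt h3 src_bpt.
Qed.

Definition D h p1 q1 q2 p2 (l1 l2 : L) : G :=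
  sum2 (fun pj qj => D0 h p1 q1 q2 p2 pj qj l1 l2) (fV C).

Lemma D_compat h p1 q1 q2 p2 : dcompat h -> dcompat (D h p1 q1 q2 p2).
Proof.
by move=> c; apply: dcompat_sum => pj qj; apply: D0_compat.
Qed.

Lemma DL_compat h : dcompat h ->
  ccompat (fun p1 q1 (l : L) q2 p2 => sum2 (D h p1 q1 q2 p2) (cop l)).
Proof.
have [bP bQ bL bQ1 bP1 bMl bMr] := bpt_compat C L.
move=> c; have [h1 h2 h3] := c; split; ia.
- by do 3! [apply: sum2_linP => ? ?]; rewrite bP h1.
- by do 3! [apply: sum2_linP => ? ?]; rewrite bQ h2.
- by apply: sum2_cop_linear; apply: D_compat.
- by do 3! [apply: sum2_linP => ? ?]; rewrite bQ1 h1.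
- by do 3! [apply: sum2_linP => ? ?]; rewrite bP1 h2.
- rewrite cop_eactl; last exact: D_compat.
  by do 3! [apply: eq_sum2 => ? ?]; rewrite bpt_srcl bpt_tgtl.
- rewrite cop_eactr; last exact: D_compat.
  by do 3! [apply: eq_sum2 => ? ?]; rewrite bpt_srcr bpt_tgtr.
Qed.
End D0.

Definition bcop (u : B) : diamond B :=
  bsum (fun p1 q1 (l : L) q2 p2 =>
    sum2 (fun l1 l2 => sum2 (fun pj qj => sum2 (fun qi pi =>
      dpure (bpt p1 qi l1 q2 pj : B) (bpt pi q1 l2 qj p2))
    (gV C)) (fV C)) (cop l)) u.

Lemma bcop_lin : linear bcop.
Proof. exact: bsum_lin (DL_compat (dpure_compat B)). Qed.

Lemma bcop_pt p1 q1 l q2 p2 : bcop (bpt p1 q1 l q2 p2) =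
  sum2 (D (dpure (A := B)) p1 q1 q2 p2) (cop l).
Proof. by rewrite [LHS]bsum_pt //; apply: (DL_compat (dpure_compat B)). Qed.

Lemma bcopK (G : lmodType k) (h : B -> B -> G) p1 q1 l q2 p2 : dcompat h ->
  sum2 h (bcop (bpt p1 q1 l q2 p2)) = sum2 (D h p1 q1 q2 p2) (cop l).
Proof.
move=> c; have lh := dsum_linear c.
rewrite bcop_pt (sum2_comp _ _ lh); apply: eq_sum2 => ? ?.
rewrite (sum2_comp _ _ lh); apply: eq_sum2 => ? ?.
rewrite (sum2_comp _ _ lh); apply: eq_sum2 => ? ?.
exact: dsumE.
Qed.

Lemma bcop_ext (G : lmodType k) (F F' : B -> G) : linear F -> linear F' ->
  (forall p q l q1 p1, F (bpt p q l q1 p1) = F' (bpt p q l q1 p1)) -> F =1 F'.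
Proof. exact: bct_ext. Qed.

Lemma bcop_takeuchi s x :
  sum2 (fun y z => dpure (y * tgt B s) z) (bcop x) =
  sum2 (fun y z => dpure y (z * src B s)) (bcop x).
Proof.
have [d1 d2 d3] := dpure_compat B.
have c1 : dcompat (fun y z => dpure (y * tgt B s) z).
  split; ia; first by rewrite mul_linl d1.
    by rewrite d2.
  by rewrite -mulrA d3.
have c2 : dcompat (fun y z => dpure y (z * src B s)).
  split; ia; first by rewrite d1.
    by rewrite mul_linl d2.
  by rewrite -mulrA d3.
move: x; apply: bcop_ext.
- by apply: (lin_comp (dsum_linear c1)); apply: bcop_lin.
- by apply: (lin_comp (dsum_linear c2)); apply: bcop_lin.
move=> p1 q1 l q2 p2; rewrite !bcopK // [LHS]sum2_swap [RHS]sum2_swap.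
pose h p q := sum2 (D0 (dpure (A := B)) p1 q1 q2 p2 p q) (cop l).
have ch : bcompat h.
  have [bP bQ bL bQ1 bP1 bMl bMr] := bpt_compat C L.
  split; ia.
  - by do 2! [apply: sum2_linP => ? ?]; rewrite bP1 d1.
  - by do 2! [apply: sum2_linP => ? ?]; rewrite bQ1 d2.
  - rewrite /h /D0.
    under eq_sum2 => ? ? do under eq_sum2 => ? ? do rewrite -bpt_tgtr.
    under [in RHS]eq_sum2 => ? ? do under eq_sum2 => ? ? do rewrite -bpt_srcr.
    by apply: (cop_takeuchiK (h := D0 _ _ _ _ _ _ _)); apply: D0_compat; apply: dpure_compat.
have := fV_central s ch; rewrite /h => E.
transitivity (sum2 (fun pi qi => h (lact s pi) qi) (fV C)).
  by do 3! [apply: eq_sum2 => ? ?]; rewrite bpt_tgt.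
rewrite fV_central //.
by do 3! [apply: eq_sum2 => ? ?]; rewrite bpt_src.
Qed.

Lemma bcop_src_tgt s t :
  bcop (src B s * tgt B t) = dpure (src B s) (tgt B t).
Proof.
have [d1 d2 d3] := dpure_compat B.
have [bP bQ bL bQ1 bP1 bMl bMr] := bpt_compat C L.
have cop1 (G : lmodType k) (h : L -> L -> G) : dcompat h -> sum2 h (cop 1) = h 1 1.
  by move=> c; rewrite -[X in cop X](eact11 L) /eact cop_src_tgt dsumE // rmorph1 tgt1.
have -> : src B s * tgt B t = beact C L s t :> B.
  by rewrite [LHS]beactM !mulr1.
have -> : src B s = beact C L s 1 :> B by [].
have -> : tgt B t = beact C L 1 t :> B by [].
rewrite /beact (sum2_comp _ _ bcop_lin).
rewrite [RHS](sum2_comp (F := (dpure (A := B))^~ _)); last exact: d1.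
apply: eq_sum2 => pi qi.
rewrite (sum2_comp _ _ bcop_lin).
rewrite [RHS](sum2_comp (F := (dpure (A := B))^~ _)); last exact: d1.
under [RHS]eq_sum2 => pb qb.
  rewrite (sum2_comp (F := dpure (A := B) _)); last exact: d2.
  under eq_sum2 => pa qa.
    rewrite (sum2_comp (F := dpure (A := B) _)); last exact: d2.
    over.
  rewrite sum2_swap; over.
rewrite [RHS]sum2_swap; apply: eq_sum2 => pj qj.
rewrite bcop_pt cop1; last by apply: D_compat; apply: dpure_compat.
rewrite [RHS]sum2_swap; apply: eq_sum2 => pa qa.
under [RHS]eq_sum2 => pb qb.
  rewrite lact1 ract1 -{1}[pa]gV_P.
  rewrite (sum2_comp _ _ (bP _ _ _ _)) (sum2_comp (F := dpure (A := B) _)); last exact: d2.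
  under eq_sum2 => qi' pi'.
    rewrite -[X in dpure _ X]src_bpt -d3 tgt_bpt -qpA bpt_tgtl mulr1 -[tgt L _]mul1r bpt_tgtr.
    rewrite -pqA.
    over.
  over.
rewrite [RHS]sum2_swap; apply: eq_sum2 => qi' pi'.
rewrite -(sum2_comp (F := (dpure (A := B))^~ _)); last exact: d1.
rewrite -(sum2_comp _ _ (bP1 _ _ _ _)) -(sum2_comp _ _ (lact_linl _)).
by rewrite sum_fV lact1.
Qed.

Lemma bcopM x y : bcop (x * y) =
  sum2 (fun x1 x2 => sum2 (fun y1 y2 => dpure (x1 * y1) (x2 * y2)) (bcop y))
    (bcop x).
Proof.
have cd := dpure_compat B; have [d1 d2 d3] := cd.
have [bP bQ bL bQ1 bP1 bMl bMr] := bpt_compat C L.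
have cr z : dcompat (fun y1 y2 => sum2 (fun x1 x2 => dpure (x1 * y1) (x2 * y2)) (bcop z)).
  by apply: dcompat_mulr => // s; apply: bcop_takeuchi.
have cl z : dcompat (fun x1 x2 => sum2 (fun y1 y2 => dpure (x1 * y1) (x2 * y2)) (bcop z)).
  apply: (@dcompat_sum _ _ _ _ _ _ _ (fun y1 y2 x1 x2 => dpure (x1 * y1) (x2 * y2))).
  by move=> *; apply: dcompat_mull.
move: x; apply: bcop_ext.
- by apply: (lin_comp bcop_lin); apply: mul_linl.
- by apply: (lin_comp (dsum_linear (cl y)) bcop_lin).
move=> p1 q1 l q2 p2; rewrite sum2_swap; move: y; apply: bcop_ext.
- by apply: (lin_comp bcop_lin); apply: mul_linr.
- by apply: (lin_comp (dsum_linear (cr _)) bcop_lin).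
move=> p3 q3 m q4 p4.
rewrite B_bmul_pt bcop_pt bcopK //.
set a := qp q2 p3; set b := qp q3 p2.
have cD := D_compat p1 q1 q4 p4 cd.
rewrite copMK // cop_eactr; last first.
  apply: (@dcompat_sum _ _ _ _ _ _ _ (fun y1 y2 x1 x2 => D _ _ _ _ _ (x1 * y1) (x2 * y2))).
  by move=> *; apply: dcompat_mull.
rewrite [LHS]sum2_swap; apply: eq_sum2 => m1 m2.
rewrite [LHS]sum2_swap; apply: eq_sum2 => pj' qj'.
transitivity (sum2 (fun qi' pi' => sum2 (fun pj qj => sum2 (fun l1 l2 =>
   D0 (dpure (A := B)) p1 q1 q4 p4 pj' qj' (l1 * tgt L (qp qi' pj) * src L a * m1)
     (l2 * src L (qp qj pi') * tgt L b * m2)) (cop l)) (fV C)) (gV C)); last first.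
  apply: eq_sum2 => qi' pi'.
  rewrite bcopK; last exact: dcompat_mull.
  rewrite [RHS]sum2_swap; do 3! [apply: eq_sum2 => ? ?].
  by rewrite !B_bmul_pt /eact -/a -/b src_tgtC !mulrA.
have cD0 := D0_compat p1 q1 q4 p4 pj' qj' cd; have [e1 e2 e3] := cD0.
under [RHS]eq_sum2 => qi' pi'.
  under eq_sum2 => pj qj.
    rewrite (cop_takeuchiK (h := fun x1 x2 =>
      D0 (dpure (A := B)) p1 q1 q4 p4 pj' qj' (x1 * src L a * m1)
        (x2 * src L (qp qj pi') * tgt L b * m2))); last first.
      split; ia.
      - by rewrite !mul_linl e1.
      - by rewrite !mul_linl e2.
      - by rewrite -!mulrA e3.
    under eq_sum2 => l1 l2 do rewrite -[l2 * _ * _]mulrA -rmorphM -qpMl qpA.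
    over.
  rewrite sum2_swap.
  under eq_sum2 => l1 l2.
    rewrite -(sum2_comp _ _ (e2 _)) -(sum2_comp _ _ (mul_linl _)).
    rewrite -(sum2_comp _ _ (mul_linl _)) -(sum2_comp _ _ (mul_linr _)).
    rewrite -(sum2_comp (F := src L)); last exact: linearP.
    rewrite -(sum2_comp _ _ (qp_linl _)) -(sum2_comp _ _ (ract_linr _)).
    rewrite sum_fV ract1.
    over.
  over.
rewrite [RHS]sum2_swap; apply: eq_sum2 => l1 l2.
rewrite -(sum2_comp _ _ (e2 _)) -(sum2_comp _ _ (mul_linl _)).
rewrite -(sum2_comp _ _ (mul_linl _)) -(sum2_comp _ _ (mul_linr _)).
rewrite -(sum2_comp (F := src L)); last exact: linearP.
by rewrite sum_gV rmorph1 mulr1.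
Qed.

End BaseChangeCop.

Section BaseChangeBialg.
Context (k : comNzRingType) (R S : algType k) (C : morita_context R S).
Context (L : xbialgebra R).
Local Notation P := (mP C).
Local Notation Q := (mQ C).
Local Notation B := (base_change_ring C L).
Local Notation bpt := (@bpt k R S C L).
Local Notation bcop := (@bcop k R S C L).
Local Notation bcou := (@bcou k R S C L).

Lemma bcouM (x y : B) s : bcou (x * y) s = bcou x (bcou y s).
Proof.
move: x; apply: bcop_ext.
- by apply: (lin_comp (bcou_lin s)); apply: mul_linl.
- exact: bcou_lin.
move=> p1 q1 l q2 p2; move: y; apply: bcop_ext.
- by apply: (lin_comp (bcou_lin s)); apply: mul_linr.
- by apply: (lin_comp (bcou_linr _)); apply: bcou_lin.
move=> p3 q3 m q4 p4.
rewrite B_bmul_pt !bcou_pt couM couM cou_eact.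
by rewrite [in RHS]qp_bal pqA !qpMr.
Qed.

Lemma bcou_src_mul s (x : B) t : bcou (src B s * x) t = s * bcou x t.
Proof. by rewrite bcouM; have := bcou_beact C L s 1 (bcou x t); rewrite mulr1. Qed.

Lemma bcou_tgt_mul s (x : B) t : bcou (tgt B s * x) t = bcou x t * s.
Proof. by rewrite bcouM; have := bcou_beact C L 1 s (bcou x t); rewrite mul1r. Qed.

Lemma cou_mul_src (l : L) u t : cou (l * src L u) t = cou l (u * t).
Proof. by rewrite couM -(eactr1 L) cou_eact mulr1. Qed.
Lemma cou_mul_tgt (l : L) u t : cou (l * tgt L u) t = cou l (t * u).
Proof. by rewrite couM -(eact1r L) cou_eact mul1r. Qed.

Lemma bcounitl (x : B) : sum2 (fun x1 x2 => tgt B (bcou x2 1) * x1) (bcop x) = x.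
Proof.
have c : dcompat (fun x1 x2 : B => tgt B (bcou x2 1) * x1).
  split; ia; first exact: mul_linr.
    by rewrite bcou_lin linearP mul_linl.
  by rewrite bcou_src_mul tgtM mulrA.
have [bP bQ bL bQ1 bP1 bMl bMr] := bpt_compat C L.
move: x; apply: bcop_ext => //.
  by apply: (lin_comp (dsum_linear c)); apply: bcop_lin.
move=> p1 q1 l q2 p2; rewrite bcopK // [LHS]sum2_swap.
transitivity (sum2 (fun pj qj => sum2 (fun l1 l2 =>
   bpt p1 q1 (tgt L (cou l2 (qp qj p2)) * l1) q2 pj) (cop l)) (fV C)).
  apply: eq_sum2 => pj qj; apply: eq_sum2 => l1 l2.
  under [LHS]eq_sum2 => qi pi.
    rewrite tgt_bpt bcou_pt ract1 -qpA qpMr.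
    over.
  rewrite -(sum2_comp _ _ (bQ _ _ _ _)) -(sum2_comp _ _ (lact_linl _)).
  by rewrite -(sum2_comp _ _ (mul_linl _)) sum_gV mul1r bpt_tgtl.
transitivity (sum2 (fun pj qj => bpt p1 q1 (l * tgt L (qp qj p2)) q2 pj) (fV C)).
  apply: eq_sum2 => pj qj.
  rewrite -(sum2_comp _ _ (bL _ _ _ _)); congr (bpt _ _ _ _ _).
  under [LHS]eq_sum2 => l1 l2 do rewrite -[qp _ _]mulr1 -cou_mul_src.
  have cc : dcompat (fun x1 x2 : L => tgt L (cou x2 1) * x1).
    split; ia; first exact: mul_linr.
      by rewrite cou_lin linearP mul_linl.
    by rewrite couM -(eactr1 L) cou_eact mulr1 tgtM mulrA.
  rewrite -(cop_takeuchiK _ _ cc) -[in RHS](counitl l) [RHS](sum2_comp _ _ (mul_linl _)).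
  by apply: eq_sum2 => ? ?; rewrite mulrA.
under eq_sum2 => pj qj do rewrite bpt_tgtr.
by rewrite -(sum2_comp _ _ (bP1 _ _ _ _)) fV_P.
Qed.

Lemma bcounitr (x : B) : sum2 (fun x1 x2 => src B (bcou x1 1) * x2) (bcop x) = x.
Proof.
have c : dcompat (fun x1 x2 : B => src B (bcou x1 1) * x2).
  split; ia; first by rewrite bcou_lin linearP mul_linl.
    exact: mul_linr.
  by rewrite bcou_tgt_mul rmorphM mulrA.
have [bP bQ bL bQ1 bP1 bMl bMr] := bpt_compat C L.
move: x; apply: bcop_ext => //.
  by apply: (lin_comp (dsum_linear c)); apply: bcop_lin.
move=> p1 q1 l q2 p2; rewrite bcopK // [LHS]sum2_swap.
transitivity (sum2 (fun pj qj => sum2 (fun l1 l2 =>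
   bpt p1 q1 (src L (cou l1 (qp q2 pj)) * l2) qj p2) (cop l)) (fV C)).
  apply: eq_sum2 => pj qj; apply: eq_sum2 => l1 l2.
  under [LHS]eq_sum2 => qi pi.
    rewrite src_bpt bcou_pt ract1.
    over.
  by rewrite -(sum2_comp _ _ (bP _ _ _ _)) gV_P bpt_srcl.
transitivity (sum2 (fun pj qj => bpt p1 q1 (l * src L (qp q2 pj)) qj p2) (fV C)).
  apply: eq_sum2 => pj qj.
  rewrite -(sum2_comp _ _ (bL _ _ _ _)); congr (bpt _ _ _ _ _).
  under [LHS]eq_sum2 => l1 l2 do rewrite -[qp _ _]mul1r -cou_mul_tgt.
  have cc : dcompat (fun x1 x2 : L => src L (cou x1 1) * x2).
    split; ia; first by rewrite cou_lin linearP mul_linl.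
      exact: mul_linr.
    by rewrite couM -(eact1r L) cou_eact mul1r rmorphM mulrA.
  rewrite (cop_takeuchiK _ _ cc) -[in RHS](counitr l) [RHS](sum2_comp _ _ (mul_linl _)).
  by apply: eq_sum2 => ? ?; rewrite mulrA.
under eq_sum2 => pj qj do rewrite bpt_srcr.
by rewrite -(sum2_comp _ _ (bQ1 _ _ _ _)) fV_Q.
Qed.

Lemma bcopA (x : B) :
  sum2 (fun x1 x2 => sum2 (fun y z => dpure3 y z x2) (bcop x1)) (bcop x) =
  sum2 (fun x1 x2 => sum2 (fun y z => dpure3 x1 y z) (bcop x2)) (bcop x).
Proof.
have [t1 t2 t3 t4 t5] := dpure3_compat B.
have ct1 z : dcompat (fun x y : B => dpure3 x y z) by split.
have ct2 (w : B) : dcompat (fun y z : B => dpure3 w y z) by split.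
have cop_src_mul (G : lmodType k) (h : B -> B -> G) s u : dcompat h ->
    sum2 h (bcop (src B s * u)) = sum2 (fun y z => h (src B s * y) z) (bcop u).
  move=> c; rewrite bcopM dsum_sum //.
  under eq_sum2 => a b do rewrite dsum_sum_pure //.
  have := bcop_src_tgt C L s 1; rewrite tgt1 mulr1 => ->.
  rewrite dsumE; first by apply: eq_sum2 => ? ?; rewrite mul1r.
  apply: (@dcompat_sum _ _ _ _ _ _ _ (fun y1 y2 x1 x2 => h (x1 * y1) (x2 * y2))).
  by move=> *; apply: dcompat_mull.
have cop_tgt_mul (G : lmodType k) (h : B -> B -> G) s u : dcompat h ->
    sum2 h (bcop (tgt B s * u)) = sum2 (fun y z => h y (tgt B s * z)) (bcop u).
  move=> c; rewrite bcopM dsum_sum //.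
  under eq_sum2 => a b do rewrite dsum_sum_pure //.
  have := bcop_src_tgt C L 1 s; rewrite rmorph1 mul1r => ->.
  rewrite dsumE; first by apply: eq_sum2 => ? ?; rewrite mul1r.
  apply: (@dcompat_sum _ _ _ _ _ _ _ (fun y1 y2 x1 x2 => h (x1 * y1) (x2 * y2))).
  by move=> *; apply: dcompat_mull.
have c1 : dcompat (fun x1 x2 : B => sum2 (fun y z => dpure3 y z x2) (bcop x1)).
  split; ia.
  - by rewrite bcop_lin (dsum_linear (ct1 _)).
  - by apply: sum2_linP => ? ?; apply: t3.
  - rewrite cop_tgt_mul //; by apply: eq_sum2 => ? ?; rewrite t5.
have c2 : dcompat (fun x1 x2 : B => sum2 (fun y z => dpure3 x1 y z) (bcop x2)).
  split; ia.
  - by apply: sum2_linP => ? ?; apply: t1.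
  - by rewrite bcop_lin (dsum_linear (ct2 _)).
  - rewrite cop_src_mul //; by apply: eq_sum2 => ? ?; rewrite t4.
move: x; apply: bcop_ext.
- by apply: (lin_comp (dsum_linear c1)); apply: bcop_lin.
- by apply: (lin_comp (dsum_linear c2)); apply: bcop_lin.
move=> p1 q1 l q2 p2; rewrite !bcopK //.
pose K pj qj pj' qj' (a b c : L) := sum2 (fun qi pi => sum2 (fun qi' pi' =>
  dpure3 (bpt p1 qi a q2 pj : B) (bpt pi qi' b qj pj') (bpt pi' q1 c qj' p2))
  (gV C)) (gV C).
have [bP bQ bL bQ1 bP1 bMl bMr] := bpt_compat C L.
have cK pj qj pj' qj' : d3compat (K pj qj pj' qj').
  split; ia.
  - by do 2! [apply: sum2_linP => ? ?]; rewrite bL t1.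
  - by do 2! [apply: sum2_linP => ? ?]; rewrite bL t2.
  - by do 2! [apply: sum2_linP => ? ?]; rewrite bL t3.
  - rewrite /K [LHS]sum2_swap [RHS]sum2_swap; apply: eq_sum2 => qi' pi'.
    under eq_sum2 => ? ? do rewrite -bpt_tgtl.
    under [in RHS]eq_sum2 => ? ? do rewrite -bpt_srcl.
    apply: (gV_central (h := fun qi pi => dpure3 (bpt _ qi _ _ _ : B) (bpt pi _ _ _ _) _)).
    split; ia.
    + by rewrite bQ t1.
    + by rewrite bP t2.
    + by rewrite -tgt_bpt t4 src_bpt.
  - apply: eq_sum2 => qi pi.
    under eq_sum2 => ? ? do rewrite -bpt_tgtl.
    under [in RHS]eq_sum2 => ? ? do rewrite -bpt_srcl.
    apply: (gV_central (h := fun qi' pi' => dpure3 _ (bpt _ qi' _ _ _ : B) (bpt pi' _ _ _ _))).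
    split; ia.
    + by rewrite bQ t2.
    + by rewrite bP t3.
    + by rewrite -tgt_bpt t5 src_bpt.
transitivity (sum2 (fun pj qj => sum2 (fun pj' qj' =>
  sum2 (fun x1 x2 => sum2 (fun y z => K pj' qj' pj qj y z x2) (cop x1)) (cop l))
  (fV C)) (fV C)).
  rewrite [LHS]sum2_swap; apply: eq_sum2 => pj qj.
  rewrite [RHS]sum2_swap; apply: eq_sum2 => l1 l2.
  rewrite [RHS]sum2_swap.
  transitivity (sum2 (fun qi pi => sum2 (fun y z => sum2 (fun pj' qj' =>
    sum2 (fun qi' pi' => dpure3 (bpt p1 qi' y q2 pj' : B) (bpt pi' qi z qj' pj)
       (bpt pi q1 l2 qj p2)) (gV C)) (fV C)) (cop l1)) (gV C)).
    by apply: eq_sum2 => qi pi; rewrite bcopK.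
  rewrite [LHS]sum2_swap; apply: eq_sum2 => y z.
  rewrite [LHS]sum2_swap; apply: eq_sum2 => pj' qj'.
  by rewrite [LHS]sum2_swap.
transitivity (sum2 (fun pj qj => sum2 (fun pj' qj' =>
  sum2 (fun x1 x2 => sum2 (fun y z => K pj' qj' pj qj x1 y z) (cop x2)) (cop l))
  (fV C)) (fV C)).
  by apply: eq_sum2 => pj qj; apply: eq_sum2 => pj' qj'; apply: copAK.
symmetry.
rewrite [LHS]sum2_swap [RHS]sum2_swap; apply: eq_sum2 => pj qj.
rewrite [RHS]sum2_swap; apply: eq_sum2 => l1 l2.
rewrite [RHS]sum2_swap.
transitivity (sum2 (fun qi pi => sum2 (fun y z => sum2 (fun pj' qj' =>
    sum2 (fun qi' pi' => dpure3 (bpt p1 qi l1 q2 pj : B) (bpt pi qi' y qj pj')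
       (bpt pi' q1 z qj' p2)) (gV C)) (fV C)) (cop l2)) (gV C)).
  by apply: eq_sum2 => qi pi; rewrite bcopK.
rewrite [LHS]sum2_swap; apply: eq_sum2 => y z.
by rewrite [LHS]sum2_swap.
Qed.

Lemma bcou_src_tgt (r s t : S) : bcou (src B r * tgt B s) t = r * t * s.
Proof.
have -> : src B r * tgt B s = beact C L r s :> B.
  by rewrite [LHS]beactM !mulr1.
exact: bcou_beact.
Qed.

Definition base_change : xbialgebra S :=
  @XBialgebra _ _ B bcop bcou (@bcop_lin _ _ _ C L) (@bcop_src_tgt _ _ _ C L)
    (@bcop_takeuchi _ _ _ C L) (@bcopM _ _ _ C L) (@bcou_lin _ _ _ C L)
    (@bcou_linr _ _ _ C L) bcou_src_tgt bcouM bcopA bcounitl bcounitr.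

End BaseChangeBialg.

(* Finitely generated projective: a direct summand of a free module of finite
   rank. *)
Definition fg_projective (A : nzRingType) (M : lmodType A) :=
  exists n (i : {linear M -> 'rV[A]_n}) (p : {linear 'rV[A]_n -> M}), cancel i p.

(* An R^e-ring as a left module over the opposite ring R^c of R, acting through
   tgt. *)
Definition tgt_module (k : comNzRingType) (R : algType k) (A : rering R) : Type := A.

Section TgtModule.
Context (k : comNzRingType) (R : algType k) (A : rering R).

HB.instance Definition _ := GRing.Zmodule.on (tgt_module A).

Definition tgt_scale (r : R^c) (x : tgt_module A) : tgt_module A :=
  tgt A r * (x : A).

Let tsA (r s : R^c) x : tgt_scale r (tgt_scale s x) = tgt_scale (r * s) x.
Proof. by rewrite /tgt_scale mulrA -tgtM. Qed.
Let ts1 : left_id 1 tgt_scale.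
Proof. by move=> x; rewrite /tgt_scale [tgt A _]tgt1 mul1r. Qed.
Let tsDr : right_distributive tgt_scale +%R.
Proof. by move=> r x y; rewrite /tgt_scale [LHS]mulrDr. Qed.
Let tsDl x : {morph tgt_scale^~ x : r s / r + s}.
Proof.
move=> r s; rewrite /tgt_scale.
have -> : tgt A (r + s) = tgt A r + tgt A s by apply: (linfD (@linearP _ _ _ _ (tgt A))).
exact: mulrDl.
Qed.

HB.instance Definition _ := GRing.Zmodule_isLmodule.Build R^c (tgt_module A)
  tsA ts1 tsDr tsDl.

Definition tgt_fgp := fg_projective (tgt_module A).

End TgtModule.

Section LeftDual.
Context (k : comNzRingType) (R : algType k).

(* Left \bar R-linear maps from A to R. *)
Record ldual (A : rering R) := LDual {
  ldual_fun :> A -> R;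
  ldual_lin : linear ldual_fun;
  ldual_tgt : forall v l, ldual_fun (tgt A v * l) = ldual_fun l * v }.

Section LdualModule.
Context (A : rering R).
Implicit Types x y z : ldual A.

Lemma ldual_ext x y : x =1 y -> x = y.
Proof.
case: x y => [f fl ft] [g gl gt] /= /funext E; subst g.
by congr LDual; apply: Prop_irrelevance.
Qed.

HB.instance Definition _ := gen_eqMixin (ldual A).
HB.instance Definition _ := gen_choiceMixin (ldual A).

Lemma ldual_comb_lin (a : k) x y : linear (fun l => a *: x l + y l).
Proof.
move=> b u v; rewrite !(ldual_lin x) !(ldual_lin y) !scalerDr !scalerA mulrC.
by rewrite addrACA.
Qed.
Lemma ldual_comb_tgt (a : k) x y v l :
  a *: x (tgt A v * l) + y (tgt A v * l) = (a *: x l + y l) * v.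
Proof. by rewrite !ldual_tgt mulrDl scalerAl. Qed.

Definition ldual_comb a x y : ldual A :=
  LDual (ldual_comb_lin a x y) (ldual_comb_tgt a x y).

Lemma ldual0_lin : linear (fun _ : A => 0 : R).
Proof. by move=> a u v; rewrite scaler0 addr0. Qed.
Lemma ldual0_tgt (v : R) (l : A) : (0 : R) = 0 * v.
Proof. by rewrite mul0r. Qed.
Definition ldual0 : ldual A := LDual ldual0_lin ldual0_tgt.

Let add x y := ldual_comb 1 x y.
Let opp x := ldual_comb (-1) x ldual0.
Let scale a x := ldual_comb a x ldual0.

Let addA : associative add.
Proof. by move=> x y z; apply: ldual_ext => l /=; rewrite !scale1r addrA. Qed.
Let addC : commutative add.
Proof. by move=> x y; apply: ldual_ext => l /=; rewrite !scale1r addrC. Qed.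
Let add0 : left_id ldual0 add.
Proof. by move=> x; apply: ldual_ext => l /=; rewrite !scale1r add0r. Qed.
Let addN : left_inverse ldual0 opp add.
Proof.
by move=> x; apply: ldual_ext => l /=; rewrite scale1r addr0 scaleN1r addNr.
Qed.

HB.instance Definition _ := GRing.isZmodule.Build (ldual A) addA addC add0 addN.

Lemma ldualD x y l : (x + y) l = x l + y l.
Proof. by rewrite [LHS](_ : _ = 1 *: x l + y l) // scale1r. Qed.

Let scaleE a x l : scale a x l = a *: x l.
Proof. by rewrite [LHS](_ : _ = a *: x l + 0) // addr0. Qed.
Let scaleA a b x : scale a (scale b x) = scale (a * b) x.
Proof. by apply: ldual_ext => l; rewrite !scaleE scalerA. Qed.
Let scale1 : left_id 1 scale.
Proof. by move=> x; apply: ldual_ext => l; rewrite !scaleE scale1r. Qed.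
Let scaleDr : right_distributive scale +%R.
Proof.
by move=> a x y; apply: ldual_ext => l; rewrite ldualD !scaleE ldualD scalerDr.
Qed.
Let scaleDl x : {morph scale^~ x : a b / a + b}.
Proof. by move=> a b; apply: ldual_ext => l; rewrite ldualD !scaleE scalerDl. Qed.

HB.instance Definition _ := GRing.Zmodule_isLmodule.Build k (ldual A)
  scaleA scale1 scaleDr scaleDl.

Lemma ldualZ a x l : (a *: x) l = a *: x l.
Proof. by rewrite [LHS](_ : _ = a *: x l + 0) // addr0. Qed.

Lemma ldual_ev_lin l : linear (fun x : ldual A => x l).
Proof. by move=> a x y; rewrite ldualD ldualZ. Qed.

End LdualModule.

Section LdualRing.
Context (L : xbialgebra R).
Implicit Types (x y z : ldual L) (l m : L).

Lemma lact_compat z : dcompat (fun l1 l2 : L => src L (z l1) * l2).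
Proof.
split; ia.
- by rewrite (ldual_lin z) linearP mul_linl.
- exact: mul_linr.
- by rewrite ldual_tgt rmorphM mulrA.
Qed.

(* zeta(l_(1)) l_(2) *)
Definition lcoact z l : L := sum2 (fun l1 l2 => src L (z l1) * l2) (cop l).

Lemma lcoact_lin z : linear (lcoact z).
Proof. exact: sum2_cop_linear (lact_compat z). Qed.
Lemma lcoact_linr l : linear (lcoact^~ l).
Proof.
by move=> a u v; apply: sum2_linP => *; rewrite ldual_ev_lin linearP mul_linl.
Qed.
Lemma lcoact_tgt z v l : lcoact z (tgt L v * l) = tgt L v * lcoact z l.
Proof.
rewrite -(eact1r L) /lcoact cop_eactl; last exact: lact_compat.
rewrite (sum2_comp _ _ (mul_linr _)); apply: eq_sum2 => ? ?.
by rewrite rmorph1 mul1r eact1r mulrA src_tgtC mulrA.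
Qed.

Lemma lmul_lin x y : linear (fun l => x (lcoact y l)).
Proof. exact: lin_comp (ldual_lin x) (lcoact_lin y). Qed.
Lemma lmul_tgt x y v l : x (lcoact y (tgt L v * l)) = x (lcoact y l) * v.
Proof. by rewrite lcoact_tgt ldual_tgt. Qed.
Definition lmul x y : ldual L := LDual (lmul_lin x y) (lmul_tgt x y).

Lemma lone_lin : linear (fun l : L => cou l 1).
Proof. exact: cou_lin. Qed.
Lemma lone_tgt v l : cou (tgt L v * l) 1 = cou l 1 * v.
Proof. by rewrite couM -(eact1r L) cou_eact mul1r. Qed.
Definition lone : ldual L := LDual lone_lin lone_tgt.

Lemma lsrc_lin r : linear (fun l : L => r * cou l 1).
Proof. by move=> a u v; rewrite cou_lin mul_linr. Qed.
Lemma lsrc_tgt r v l : r * cou (tgt L v * l) 1 = r * cou l 1 * v.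
Proof. by rewrite lone_tgt mulrA. Qed.
(* r \bar 1 times the unit *)
Definition lsrc r : ldual L := LDual (lsrc_lin r) (lsrc_tgt r).

Lemma ltgt_lin s : linear (fun l : L => cou (l * tgt L s) 1).
Proof. by move=> a u v; rewrite mul_linl cou_lin. Qed.
Lemma ltgt_tgt s v l : cou (tgt L v * l * tgt L s) 1 = cou (l * tgt L s) 1 * v.
Proof. by rewrite -mulrA lone_tgt. Qed.
(* 1 \bar s times the unit *)
Definition ltgt s : ldual L := LDual (ltgt_lin s) (ltgt_tgt s).

Lemma cou_tgtr l s t : cou (l * tgt L s) t = cou l (t * s).
Proof. by rewrite couM -(eact1r L) cou_eact mul1r. Qed.
Lemma cou_srcr l s t : cou (l * src L s) t = cou l (s * t).
Proof. by rewrite couM -(eactr1 L) cou_eact mulr1. Qed.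
Lemma cou_srcl l s t : cou (src L s * l) t = s * cou l t.
Proof. by rewrite couM -(eactr1 L) cou_eact mulr1. Qed.

Lemma counitl_compat : dcompat (fun x1 x2 : L => tgt L (cou x2 1) * x1).
Proof.
split; ia; first exact: mul_linr.
  by rewrite cou_lin linearP mul_linl.
by rewrite cou_srcl tgtM mulrA.
Qed.
Lemma counitr_compat : dcompat (fun x1 x2 : L => src L (cou x1 1) * x2).
Proof.
split; ia; first by rewrite cou_lin linearP mul_linl.
  exact: mul_linr.
by rewrite lone_tgt rmorphM mulrA.
Qed.

Lemma lsrc_mul r x l : lmul (lsrc r) x l = r * x l.
Proof.
rewrite /= /lcoact (sum2_comp _ _ (@cou_lin _ _ L 1)); congr (_ * _).
under eq_sum2 => ? ? do rewrite cou_srcl -ldual_tgt.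
by rewrite -(sum2_comp _ _ (ldual_lin x)) counitl.
Qed.
Lemma ltgt_mul s x l : lmul (ltgt s) x l = x (l * tgt L s).
Proof.
rewrite /= cou_tgtr mul1r /lcoact (sum2_comp _ _ (@cou_lin _ _ L s)).
under eq_sum2 => ? ? do rewrite cou_srcl -ldual_tgt -[s in cou _ s]mul1r -cou_tgtr.
rewrite -(sum2_comp _ _ (ldual_lin x)) -[in RHS](counitl (l * tgt L s)).
rewrite -(eact1r L) cop_eactr; last exact: counitl_compat.
by congr (x _); apply: eq_sum2 => ? ?; rewrite rmorph1 mulr1 eact1r.
Qed.
Lemma mul_lsrc r x l : lmul x (lsrc r) l = x (src L r * l).
Proof.
congr (x _); rewrite /= /lcoact -[in RHS](counitr (src L r * l)).
rewrite -(eactr1 L) cop_eactl; last exact: counitr_compat.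
by apply: eq_sum2 => ? ?; rewrite /= tgt1 mul1r cou_srcl.
Qed.
Lemma mul_ltgt s x l : lmul x (ltgt s) l = x (l * src L s).
Proof.
congr (x _); rewrite /= /lcoact -[in RHS](counitr (l * src L s)).
rewrite -(eactr1 L) cop_eactr; last exact: counitr_compat.
apply: eq_sum2 => ? ?; rewrite /= tgt1 mulr1 cou_tgtr cou_srcr.
by rewrite mul1r mulr1.
Qed.

Lemma lmul_linl y : linear (lmul^~ y).
Proof.
move=> a u v; apply: ldual_ext => l; rewrite [RHS]ldual_ev_lin.
exact: (ldual_ev_lin (lcoact y l)).
Qed.
Lemma lmul_linr x : linear (lmul x).
Proof.
move=> a u v; apply: ldual_ext => l; rewrite !ldual_ev_lin /=.
by rewrite lcoact_linr (ldual_lin x).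
Qed.
Lemma lone_src : lone = lsrc 1.
Proof. by apply: ldual_ext => l /=; rewrite mul1r. Qed.

Lemma lcoactA y z l : lcoact y (lcoact z l) = lcoact (lmul y z) l.
Proof.
rewrite [LHS](sum2_comp (F := lcoact y)); last exact: lcoact_lin.
have c : d3compat (fun a b c : L => src L (y (src L (z a) * b)) * c).
  split; ia.
  - by rewrite (ldual_lin z) linearP mul_linl (ldual_lin y) linearP mul_linl.
  - by rewrite mul_linr (ldual_lin y) linearP mul_linl.
  - by rewrite mul_linr.
  - by rewrite ldual_tgt rmorphM mulrA.
  - by rewrite mulrA src_tgtC -mulrA ldual_tgt rmorphM mulrA.
transitivity (sum2 (fun x1 x2 : L =>
  sum2 (fun a b : L => src L (y (src L (z x1) * a)) * b) (cop x2)) (cop l)).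
  apply: eq_sum2 => a b; rewrite -(eactr1 L) /lcoact cop_eactl; last exact: lact_compat.
  by apply: eq_sum2 => ? ?; rewrite tgt1 mul1r eactr1.
rewrite -(copAK _ c); apply: eq_sum2 => a b /=.
rewrite /lcoact (sum2_comp _ _ (ldual_lin y)) (sum2_comp (F := src L)); last exact: linearP.
by rewrite (sum2_comp _ _ (mul_linl _)).
Qed.

Lemma lmulA : associative lmul.
Proof. by move=> x y z; apply: ldual_ext => l /=; rewrite lcoactA. Qed.
Lemma lmul1l : left_id lone lmul.
Proof. by move=> x; apply: ldual_ext => l; rewrite lone_src lsrc_mul mul1r. Qed.
Lemma lmul1r : right_id lone lmul.
Proof.
by move=> x; apply: ldual_ext => l; rewrite lone_src mul_lsrc rmorph1 mul1r.
Qed.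
Lemma lmulDl : left_distributive lmul +%R.
Proof. by move=> u v w; rewrite (linfD (lmul_linl w)). Qed.
Lemma lmulDr : right_distributive lmul +%R.
Proof. by move=> u v w; rewrite (linfD (lmul_linr u)). Qed.
Lemma lone_neq0 : lone != 0.
Proof.
apply/eqP => E; have : lone 1 = (0 : ldual L) 1 by rewrite E.
by rewrite /= cou1 => /eqP; rewrite oner_eq0.
Qed.

HB.instance Definition _ := GRing.Zmodule_isNzRing.Build (ldual L)
  lmulA lmul1l lmul1r lmulDl lmulDr lone_neq0.

Lemma ldual_scaleAl a x y : a *: (x * y) = (a *: x) * y.
Proof. by rewrite [LHS](esym (linfZ (lmul_linl y) _ _)). Qed.
Lemma ldual_scaleAr a x y : a *: (x * y) = x * (a *: y).
Proof. by rewrite [LHS](esym (linfZ (lmul_linr x) _ _)). Qed.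
HB.instance Definition _ := GRing.Lmodule_isLalgebra.Build k (ldual L) ldual_scaleAl.
HB.instance Definition _ := GRing.Lalgebra_isAlgebra.Build k (ldual L) ldual_scaleAr.

Lemma lsrc_linear : linear lsrc.
Proof. by move=> a u v; apply: ldual_ext => l; rewrite ldual_ev_lin /= mul_linl. Qed.
Lemma ltgt_linear : linear ltgt.
Proof.
move=> a u v; apply: ldual_ext => l; rewrite ldual_ev_lin /= linearP.
by rewrite mul_linr cou_lin.
Qed.
HB.instance Definition _ := GRing.isLinear.Build k R (ldual L) _ lsrc lsrc_linear.
Lemma lsrc_monoid : monoid_morphism lsrc.
Proof.
split=> [|r s]; first by rewrite -lone_src.
by apply: ldual_ext => l; rewrite [RHS]lsrc_mul /= mulrA.
Qed.
HB.instance Definition _ := GRing.isMonoidMorphism.Build R (ldual L) lsrc lsrc_monoid.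
HB.instance Definition _ := GRing.isLinear.Build k R (ldual L) _ ltgt ltgt_linear.
Lemma ltgt1 : ltgt 1 = 1.
Proof. by apply: ldual_ext => l; rewrite /= cou_tgtr mulr1. Qed.
Lemma ltgtM r s : ltgt (r * s) = ltgt s * ltgt r.
Proof. by apply: ldual_ext => l; rewrite [RHS]ltgt_mul /= !cou_tgtr !mul1r. Qed.
Lemma lsrc_tgtC r s : lsrc r * ltgt s = ltgt s * lsrc r.
Proof.
by apply: ldual_ext => l; rewrite [LHS]lsrc_mul [RHS]ltgt_mul /=.
Qed.

Definition left_dual_ring : rering R :=
  @RERing _ _ (ldual L) lsrc ltgt ltgt1 ltgtM lsrc_tgtC.

Local Notation D := left_dual_ring.

Lemma dsrc_mul r (x : D) l : (src D r * x : ldual L) l = r * (x : ldual L) l.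
Proof. exact: lsrc_mul. Qed.
Lemma dtgt_mul r (x : D) l : (tgt D r * x : ldual L) l = (x : ldual L) (l * tgt L r).
Proof. exact: ltgt_mul. Qed.
Lemma dmul_src r (x : D) l : (x * src D r : ldual L) l = (x : ldual L) (src L r * l).
Proof. exact: mul_lsrc. Qed.
Lemma dmul_tgt r (x : D) l : (x * tgt D r : ldual L) l = (x : ldual L) (l * src L r).
Proof. exact: mul_ltgt. Qed.

Lemma left_dual_bimod r s t u (x : D) l :
  (src D r * tgt D s * x * src D t * tgt D u : ldual L) l =
  r * (x : ldual L) (src L t * l * src L u * tgt L s).
Proof. by rewrite dmul_tgt dmul_src -mulrA dsrc_mul dtgt_mul !mulrA. Qed.

Definition dpair (u : diamond D) l m : R :=
  sum2 (fun x y : D => (x : ldual L) (l * tgt L ((y : ldual L) m))) u.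

Lemma dpair_compat l m :
  dcompat (fun x y : D => (x : ldual L) (l * tgt L ((y : ldual L) m))).
Proof.
split; ia.
- exact: ldual_ev_lin.
- by rewrite ldual_ev_lin linearP mul_linr ldual_lin.
- by rewrite dtgt_mul dsrc_mul tgtM mulrA.
Qed.

Lemma dpair_lin l m : linear (fun u => dpair u l m).
Proof. exact: dsum_linear (dpair_compat l m). Qed.
Lemma dpairE (x y : D) l m :
  dpair (dpure x y) l m = (x : ldual L) (l * tgt L ((y : ldual L) m)).
Proof. by rewrite /dpair dsumE //; apply: dpair_compat. Qed.

Section Projective.
Context (H : tgt_fgp L).

Lemma dual_basis : exists n (e : 'I_n -> L) (c : 'I_n -> ldual L),
  forall l, l = \sum_(j < n) tgt L (c j l) * e j.
Proof.
have [n [i [p K]]] := H.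
have tk (a : k) (l : L) : a *: l = tgt L (a *: 1 : R) * l.
  by rewrite linearZ tgt1 -scalerAl mul1r.
have il (j : 'I_n) : linear (fun l : L => (i l 0 j : R)).
  move=> a u v; rewrite tk.
  have -> : i (tgt L (a *: 1) * u + v) = (a *: 1 : R^c) *: i u + i v.
    exact: (@linearP _ _ _ _ i).
  rewrite !mxE; congr (_ + _).
  by rewrite [LHS](_ : _ = (i u 0 j : R) * (a *: 1 : R)) // -scalerAr mulr1.
have it (j : 'I_n) v (l : L) : (i (tgt L v * l) 0 j : R) = (i l 0 j : R) * v.
  have -> : i (tgt L v * l) = (v : R^c) *: i l by rewrite -[in LHS]/((v : R^c) *: (l : tgt_module L)) linearZ.
  by rewrite !mxE.
exists n, (fun j => p (delta_mx 0 j)), (fun j => LDual (il j) (it j)) => l /=.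
rewrite -[LHS](K l) [i l in LHS]row_sum_delta linear_sum.
by apply: eq_bigr => j _; rewrite linearZ.
Qed.

Lemma src_expand n (e : 'I_n -> L) (c : 'I_n -> ldual L) :
  (forall l, l = \sum_(j < n) tgt L (c j l) * e j) ->
  forall y : D, y = \sum_j (src D ((y : ldual L) (e j)) * (c j : D)).
Proof.
move=> E y; apply: ldual_ext => l.
rewrite (linf_sum (@ldual_ev_lin L l)) {1}[l]E (linf_sum (ldual_lin y)).
by apply: eq_bigr => j _; rewrite dsrc_mul ldual_tgt.
Qed.

Lemma dpair_inj (u v : diamond D) : (forall l m, dpair u l m = dpair v l m) -> u = v.
Proof.
have [n [e [c E]]] := dual_basis; have S := src_expand E.
have [d1 d2 d3] := dpure_compat D.
have X (w : diamond D) : w = \sum_j dpure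
    (sum2 (fun x y : D => tgt D ((y : ldual L) (e j)) * x) w) (c j : D).
  have lj j : dcompat (fun x y : D => tgt D ((y : ldual L) (e j)) * x).
    split; ia; first exact: mul_linr.
      by rewrite ldual_ev_lin linearP mul_linl.
    by rewrite dsrc_mul tgtM mulrA.
  move: w; apply: linear_pres_ext => [||[x y]].
  - by [].
  - move=> a u1 u2; rewrite scaler_sumr -big_split; apply: eq_bigr => j _ /=.
    by rewrite (dsum_linear (lj j)) d1.
  rewrite -[pgen _ _]/(dpure x y) {1}[y]S (linf_sum (d2 x)).
  by apply: eq_bigr => j _; rewrite -d3 dsumE.
move=> uv; rewrite [u]X [v]X; apply: eq_bigr => j _; congr dpure.
apply: ldual_ext => l; rewrite !(sum2_comp _ _ (@ldual_ev_lin L l)).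
under eq_sum2 => ? ? do rewrite dtgt_mul.
under [in RHS]eq_sum2 => ? ? do rewrite dtgt_mul.
exact: uv.
Qed.

Definition dpair3 (u : diamond3 D) l m n : R :=
  sum3 (fun x y z : D => (x : ldual L)
    (l * tgt L ((y : ldual L) (m * tgt L ((z : ldual L) n))))) u.

Lemma dpair3_compat l m n : d3compat (fun x y z : D => (x : ldual L)
    (l * tgt L ((y : ldual L) (m * tgt L ((z : ldual L) n))))).
Proof.
split; ia.
- exact: ldual_ev_lin.
- by rewrite ldual_ev_lin linearP mul_linr ldual_lin.
- by rewrite ldual_ev_lin linearP mul_linr (ldual_lin _) linearP mul_linr ldual_lin.
- by rewrite dtgt_mul dsrc_mul tgtM mulrA.
- by rewrite dtgt_mul dsrc_mul tgtM mulrA.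
Qed.

Lemma dpair3_inj (u v : diamond3 D) :
  (forall l m n, dpair3 u l m n = dpair3 v l m n) -> u = v.
Proof.
have [N [e [c E]]] := dual_basis; have S := src_expand E.
have [d1 d2 d3 d4 d5] := dpure3_compat D.
pose f i j (x y z : D) : D := tgt D ((y : ldual L) (e i * tgt L ((z : ldual L) (e j)))) * x.
have fc i j : d3compat (f i j).
  rewrite /f; split; ia.
  - exact: mul_linr.
  - by rewrite ldual_ev_lin linearP mul_linl.
  - by rewrite ldual_ev_lin linearP mul_linr (ldual_lin _) linearP mul_linl.
  - by rewrite dsrc_mul tgtM mulrA.
  - by rewrite dtgt_mul dsrc_mul tgtM mulrA.
have X (w : diamond3 D) : w = \sum_j \sum_i dpure3 (sum3 (f i j) w) (c i : D) (c j : D).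
  move: w; apply: linear_pres_ext => [||[[x y] z]].
  - by [].
  - move=> a u1 u2; rewrite scaler_sumr -big_split; apply: eq_bigr => j _ /=.
    rewrite scaler_sumr -big_split; apply: eq_bigr => i _ /=.
    by rewrite (sum3_linear (fc i j)) d1.
  rewrite -[pgen _ _]/(dpure3 x y z) {1}[z]S (linf_sum (d3 x y)).
  apply: eq_bigr => j _; rewrite -d5.
  rewrite {1}[tgt D _ * y]S (linf_sum (F := fun t => dpure3 x t _)); last exact: d2.
  by apply: eq_bigr => i _; rewrite -d4 sum3E // /f dtgt_mul.
move=> uv; rewrite [u]X [v]X; apply: eq_bigr => j _; apply: eq_bigr => i _.
congr dpure3; apply: ldual_ext => l.
have Y (w : diamond3 D) : (sum3 (f i j) w : ldual L) l = dpair3 w l (e i) (e j).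
  rewrite /sum3 (psum_comp _ _ (@ldual_ev_lin L l)).
  by apply: eq_psum => -[[? ?] ?]; apply: dtgt_mul.
by rewrite !Y uv.
Qed.

Lemma ldcop_ex (x : ldual L) :
  exists u : diamond D, forall l m, x (l * m) = dpair u l m.
Proof.
have [n [e [c E]]] := dual_basis.
have gl j : linear (fun l => x (l * e j)).
  by move=> a u v; rewrite mul_linl ldual_lin.
have gt j v l : x (tgt L v * l * e j) = x (l * e j) * v.
  by rewrite -mulrA ldual_tgt.
exists (\sum_j dpure (LDual (gl j) (gt j) : D) (c j : D)) => l m.
rewrite (linf_sum (dpair_lin l m)) {1}[m]E mulr_sumr (linf_sum (ldual_lin x)).
by apply: eq_bigr => j _; rewrite dpairE /= mulrA.
Qed.

(* The comultiplication of the left dual, determined by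
   x (l m) = x_(1) (l \bar{x_(2) (m)}); uniqueness is dpair_inj. *)
Definition ldcop (x : D) : diamond D := projT1 (cid (ldcop_ex x)).

Lemma ldcopE (x : D) l m :
  (x : ldual L) (l * m) =
  sum2 (fun x1 x2 : D => (x1 : ldual L) (l * tgt L ((x2 : ldual L) m))) (ldcop x).
Proof. exact: (projT2 (cid (ldcop_ex x)) l m). Qed.

Lemma dpair_cop (x : D) l m : dpair (ldcop x) l m = (x : ldual L) (l * m).
Proof. exact: (esym (ldcopE x l m)). Qed.

(* The values at 1 determine the counit:
   ldcou x r = ldcou (x * src D r) 1 = (x * src D r) 1 = x (src L r). *)
Definition ldcou (x : D) (r : R) : R := (x : ldual L) (src L r).

Lemma ldcop_lin : linear ldcop.
Proof.
move=> a x y; apply: dpair_inj => l m.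
by rewrite dpair_lin !dpair_cop ldual_ev_lin.
Qed.

Lemma ldcop_src_tgt r s : ldcop (src D r * tgt D s) = dpure (src D r) (tgt D s).
Proof.
apply: dpair_inj => l m; rewrite dpair_cop dpairE dsrc_mul /= !cou_tgtr !mul1r.
by rewrite couM.
Qed.

Lemma ldcop_takeuchi s (x : D) :
  sum2 (fun y z : D => dpure (y * tgt D s) z) (ldcop x) =
  sum2 (fun y z : D => dpure y (z * src D s)) (ldcop x).
Proof.
apply: dpair_inj => l m.
rewrite ![dpair (sum2 _ _) _ _](sum2_comp _ _ (dpair_lin l m)).
under eq_sum2 => y z do rewrite dpairE dmul_tgt -mulrA -src_tgtC mulrA.
under [in RHS]eq_sum2 => y z do rewrite dpairE dmul_src.
by rewrite -!ldcopE mulrA.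
Qed.

Lemma ldcopM (x y : D) : ldcop (x * y) =
  sum2 (fun x1 x2 : D => sum2 (fun y1 y2 : D => dpure (x1 * y1) (x2 * y2)) (ldcop y))
    (ldcop x).
Proof.
apply: dpair_inj => l m; rewrite dpair_cop.
rewrite [RHS](sum2_comp _ _ (dpair_lin l m)).
have lt (z : ldual L) a v : lcoact z (a * tgt L v) = lcoact z a * tgt L v.
  rewrite -(eact1r L) /lcoact cop_eactr; last exact: lact_compat.
  rewrite (sum2_comp _ _ (mul_linl _)); apply: eq_sum2 => ? ?.
  by rewrite rmorph1 mulr1 eact1r mulrA.
transitivity (sum2 (fun y1 y2 : D =>
  (x : ldual L) (lcoact y1 l * lcoact y2 m)) (ldcop y)); last first.
  rewrite [RHS](eq_sum2 (h' := fun x1 x2 : D => sum2 (fun y1 y2 : D =>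
    (x1 : ldual L) (lcoact y1 l * tgt L ((x2 : ldual L) (lcoact y2 m)))) (ldcop y))).
    rewrite [RHS]sum2_swap; apply: eq_sum2 => y1 y2; exact: ldcopE.
  move=> x1 x2; rewrite (sum2_comp _ _ (dpair_lin l m)).
  by apply: eq_sum2 => y1 y2; rewrite dpairE /= lt.
rewrite -(sum2_comp _ _ (ldual_lin x)); congr ((x : ldual L) _).
rewrite /= /lcoact copMK; last exact: lact_compat.
transitivity (sum2 (fun l1 l2 : L => sum2 (fun m1 m2 : L => sum2 (fun y1 y2 : D =>
   src L ((y1 : ldual L) (l1 * tgt L ((y2 : ldual L) m1))) * (l2 * m2)) (ldcop y))
   (cop m)) (cop l)).
  apply: eq_sum2 => l1 l2; apply: eq_sum2 => m1 m2; rewrite ldcopE.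
  by rewrite (sum2_comp (F := src L)) ?(sum2_comp _ _ (mul_linl _)) //; apply: linearP.
transitivity (sum2 (fun y1 y2 : D => sum2 (fun m1 m2 : L => sum2 (fun l1 l2 : L =>
   src L ((y1 : ldual L) l1) * (l2 * src L ((y2 : ldual L) m1) * m2)) (cop l))
   (cop m)) (ldcop y)).
  rewrite [LHS]sum2_swap.
  rewrite [RHS]sum2_swap; apply: eq_sum2 => m1 m2.
  rewrite [LHS]sum2_swap; apply: eq_sum2 => y1 y2.
  apply: (cop_takeuchiK (h := fun l1 l2 => src L ((y1 : ldual L) l1) * (l2 * m2))).
  split; ia.
  - by rewrite ldual_lin linearP mul_linl.
  - by rewrite mul_linl mul_linr.
  - by rewrite ldual_tgt rmorphM !mulrA.
apply: eq_sum2 => y1 y2; rewrite [LHS]sum2_swap.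
rewrite (sum2_comp _ _ (mul_linl _)); apply: eq_sum2 => l1 l2.
rewrite (sum2_comp _ _ (mul_linr _)); apply: eq_sum2 => m1 m2.
by rewrite !mulrA.
Qed.

Lemma ldcou_lin r : linear (ldcou^~ r).
Proof. exact: ldual_ev_lin. Qed.
Lemma ldcou_linr x : linear (ldcou x).
Proof. by move=> a u v; rewrite /ldcou linearP ldual_lin. Qed.
Lemma ldcou_src_tgt r s t : ldcou (src D r * tgt D s) t = r * t * s.
Proof. by rewrite /ldcou dsrc_mul /= cou_tgtr mul1r -(eactr1 L) cou_eact mulr1 mulrA. Qed.
Lemma ldcouM (x y : D) r : ldcou (x * y) r = ldcou x (ldcou y r).
Proof.
rewrite /ldcou /= /lcoact.
have := @cop_src_tgt _ _ L r 1; rewrite tgt1 mulr1 => ->.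
by rewrite dsumE ?mulr1 //; apply: lact_compat.
Qed.
Lemma ldcounitl (x : D) : sum2 (fun x1 x2 : D => tgt D (ldcou x2 1) * x1) (ldcop x) = x.
Proof.
apply: ldual_ext => l; rewrite (sum2_comp _ _ (@ldual_ev_lin L l)) -[in RHS](mulr1 l) ldcopE.
by apply: eq_sum2 => ? ?; rewrite dtgt_mul /ldcou rmorph1.
Qed.
Lemma ldcounitr (x : D) : sum2 (fun x1 x2 : D => src D (ldcou x1 1) * x2) (ldcop x) = x.
Proof.
apply: ldual_ext => l; rewrite (sum2_comp _ _ (@ldual_ev_lin L l)) -[in RHS](mul1r l) ldcopE.
by apply: eq_sum2 => ? ?; rewrite dsrc_mul /ldcou rmorph1 -ldual_tgt mulr1 mul1r.
Qed.

Lemma ldcopA (x : D) :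
  sum2 (fun x1 x2 : D => sum2 (fun y z : D => dpure3 y z x2) (ldcop x1)) (ldcop x) =
  sum2 (fun x1 x2 : D => sum2 (fun y z : D => dpure3 x1 y z) (ldcop x2)) (ldcop x).
Proof.
apply: dpair3_inj => l m n.
have lin := sum3_linear (dpair3_compat l m n).
rewrite /dpair3 !(sum2_comp _ _ lin).
transitivity ((x : ldual L) (l * m * n)).
  rewrite ldcopE; apply: eq_sum2 => x1 x2.
  rewrite (sum2_comp _ _ lin) -mulrA ldcopE; apply: eq_sum2 => y z.
  by rewrite sum3E //; apply: dpair3_compat.
rewrite -mulrA ldcopE; apply: eq_sum2 => x1 x2.
rewrite (sum2_comp _ _ lin) [(x2 : ldual L) (m * n)]ldcopE.
have l1 : linear (fun t => (x1 : ldual L) (l * tgt L t)).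
  by move=> a u v; rewrite linearP mul_linr ldual_lin.
rewrite (sum2_comp _ _ l1); apply: eq_sum2 => y z.
by rewrite sum3E //; apply: dpair3_compat.
Qed.

Definition left_dual : xbialgebra R :=
  @XBialgebra _ _ D ldcop ldcou ldcop_lin ldcop_src_tgt ldcop_takeuchi ldcopM
    ldcou_lin ldcou_linr ldcou_src_tgt ldcouM ldcopA ldcounitl ldcounitr.

End Projective.

End LdualRing.

End LeftDual.

(* Main.v *)
(* Write E for the base change of the left dual of L and B for the base change of L.
   The map E -> ldual B is given by the pairing
     <p1 \bar q1 (x) x (x) q2 \bar p2, p3 \bar q3 (x) l (x) q4 \bar p4>
       = p1 x((q2 p3) l (q4 p2) \bar{q1 p4}) q3,
   and its inverse is obtained by inserting p_i (x) q^i = 1 between each of the four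
   pairs of entries coupled by the pairing. Inserting these same expressions into an
   element of B and expanding the middle factor in a dual basis (e_j, c_j) of L gives a
   finite dual basis of B, whose coordinate functions are pairings with elements
   p^i \bar{q^b} (x) c_j (x) q^c \bar{p_d}. Compatibility with products and coproducts
   comes down to one use of the Takeuchi condition, of L and of its dual
   respectively. *)
From HB Require Import structures.
Require Import Defs.
From mathcomp Require Import all_boot all_algebra.
From mathcomp Require Import boolp freeg.

Set Implicit Arguments.
Unset Strict Implicit.
Unset Printing Implicit Defensive.

Import GRing.Theory.
Local Open Scope ring_scope.

(** * Two-sided scalar actions on the left dual *)

Section LdualAction.
Context (k : comNzRingType) (R : algType k) (L : xbialgebra R).
Implicit Types (x : ldual L) (l : L) (a r s : R).

Lemma ldual_src_tgt x a r s l :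
  x (src L a * (src L r * (tgt L s * l))) = x (src L (a * r) * l) * s.
Proof. by rewrite -ldual_tgt !mulrA -rmorphM src_tgtC. Qed.

Lemma eact_ldual (x : left_dual_ring L) r s l :
  (eact (left_dual_ring L) r s * x : ldual L) l = r * (x : ldual L) (l * tgt L s).
Proof. by rewrite /eact -mulrA dsrc_mul dtgt_mul. Qed.

Lemma ldual_eact (x : left_dual_ring L) r s l :
  (x * eact (left_dual_ring L) r s : ldual L) l
  = (x : ldual L) (src L r * l * src L s).
Proof. by rewrite /eact mulrA dmul_tgt dmul_src mulrA. Qed.

(** Comultiplication sends source factors to the first leg and target factors to the second. This
    puts an argument of the pairing into Sweedler form before a product of functionals is
    evaluated. *)
Lemma lcoact_src_eact x a b c l :
  lcoact x (src L a * l * eact L b c)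
  = sum2 (fun l1 l2 : L => src L (x (src L a * l1 * src L b)) * (l2 * tgt L c))
      (cop l).
Proof.
have xc := lact_compat x.
rewrite -[src L a in LHS]eactr1 /lcoact cop_eactr // cop_eactl;
  last exact: (dcompat_mull (src L b) (tgt L c) xc).
by apply: eq_sum2 => ? ?; rewrite tgt1 mul1r.
Qed.

End LdualAction.

(** * Inverting isomorphisms of bialgebras *)

Section Morphisms.
Context (k : comNzRingType) (R : algType k).

Lemma dcompat_morph (A B : rering R) (phi : {lrmorphism A -> B}) (G : lmodType k)
    (h : B -> B -> G) :
  (forall r, phi (src A r) = src B r) -> (forall r, phi (tgt A r) = tgt B r) ->
  dcompat h -> dcompat (fun x y => h (phi x) (phi y)).
Proof.
move=> phis phit [h1 h2 h3]; split=> [n a m m'|m a n n'|m r n].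
- by rewrite linearP h1.
- by rewrite linearP h2.
- by rewrite !rmorphM /= phis phit h3.
Qed.

(** The map constructed below runs opposite to the direction stated in the theorem. For the inverse,
    compatibility with comultiplication follows by applying [psi] to both legs, which is well
    defined on the diamond product since [psi] preserves source and target. *)
Lemma xiso_sym (A B : xbialgebra R) : xiso A B -> xiso B A.
Proof.
move=> [phi [[psi phiK psiK] phis phit phic phiv]].
pose psi1 := GRing.isLinear.Build _ _ _ _ psi (can2_linear phiK psiK).
pose psi2 := GRing.isMonoidMorphism.Build _ _ psi (can2_monoid_morphism phiK psiK).
pose psi' : {lrmorphism B -> A} := HB.pack psi psi1 psi2.
have psis r : psi' (src B r) = src A r by apply: (canLR phiK).
have psit r : psi' (tgt B r) = tgt A r by apply: (canLR phiK).
exists psi'; split=> //; first by exists phi.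
- move=> x; rewrite -{2}[x]psiK phic dsum_sum_pure; last first.
    exact: (dcompat_morph psis psit (dpure_compat A)).
  by under [RHS]eq_sum2 => y z do rewrite /= !phiK; rewrite sum2_dpure.
- by move=> x; rewrite -phiv /= psiK.
Qed.

End Morphisms.

(** * Dual bases through finite-rank endomorphisms *)

Section FiniteRank.
Context (k : comNzRingType) (R : algType k) (A : rering R).

(** The dual basis sought for the base change is indexed by tensors such as $f^{-1}(1)$, which have
    no preferred expression as a sum. Asking only that some list exists lets it be obtained from
    closure under linear combinations. *)
Definition finite_rank (F : A -> A) :=
  exists s : seq (A * ldual A), forall u, F u = \sum_(z <- s) tgt A (z.2 u) * z.1.

Lemma finite_rank1 (e : A) (c : ldual A) : finite_rank (fun u => tgt A (c u) * e).
Proof. by exists [:: (e, c)] => u; rewrite big_seq1. Qed.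

Lemma finite_rank_comb a F G :
  finite_rank F -> finite_rank G -> finite_rank (fun u => a *: F u + G u).
Proof.
move=> [s sF] [t tG]; exists ([seq (a *: z.1, z.2) | z <- s] ++ t) => u.
rewrite big_cat big_map sF tG scaler_sumr; congr (_ + _).
by apply: eq_bigr => z _; rewrite scalerAr.
Qed.

Lemma finite_rank_sum I (r : seq I) (F : I -> A -> A) :
  (forall i, finite_rank (F i)) -> finite_rank (fun u => \sum_(i <- r) F i u).
Proof.
move=> rF; elim: r => [|i r IH].
  by exists [::] => u; rewrite !big_nil.
have [s sE] := finite_rank_comb 1 (rF i) IH.
by exists s => u; rewrite big_cons -sE scale1r.
Qed.

Lemma finite_rank_sum2 (X Y : choiceType) (rel : {freeg (X * Y) / k} -> Prop)
    (F : X -> Y -> A -> A) (w : presmod rel) :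
  (forall x y, finite_rank (F x y)) ->
  finite_rank (fun u => sum2 (fun x y => F x y u) w).
Proof.
move=> rF; rewrite /sum2 /psum.
elim/freeg_ind_dom0: (repr w) => [|a [x y] g _ _ IH].
  by exists [::] => u; rewrite fglift0 big_nil.
have [s sE] := finite_rank_comb a (rF x y) IH.
by exists s => u; rewrite fgliftD liftU -sE.
Qed.

(** The functionals in the list give the embedding into a free module over [R^c], the elements its
    retraction. *)
Lemma finite_rank_id : finite_rank id -> tgt_fgp A.
Proof.
move=> [s sE]; pose n := size s.
pose z (j : 'I_n) := tnth (in_tuple s) j.
pose i (u : tgt_module A) : 'rV[R^c]_n := \row_j ((z j).2 u : R^c).
pose p (r : 'rV[R^c]_n) : tgt_module A := \sum_j r 0 j *: ((z j).1 : tgt_module A).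
have li : linear i.
  move=> a u v; apply/rowP => j; rewrite !mxE.
  rewrite [LHS](_ : _ = (z j).2 (tgt A a * u + v)) //.
  by rewrite (linfD (ldual_lin _)) ldual_tgt.
have lp : linear p.
  move=> a u v; rewrite /p scaler_sumr -big_split; apply: eq_bigr => j _.
  by rewrite !mxE scalerDl scalerA.
pose iL := GRing.isLinear.Build _ _ _ _ i li.
pose pL := GRing.isLinear.Build _ _ _ _ p lp.
pose i' : {linear tgt_module A -> 'rV[R^c]_n} := HB.pack i iL.
pose p' : {linear 'rV[R^c]_n -> tgt_module A} := HB.pack p pL.
exists n, i', p' => u /=.
rewrite [RHS](sE u) big_tnth; apply: eq_bigr => j _.
by rewrite mxE.
Qed.

End FiniteRank.

(** * The pairing and the map it induces *)

Section Duality.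
Context (k : comNzRingType) (R S : algType k) (C : morita_context R S).
Context (L : xbialgebra R) (HL : tgt_fgp L).
Local Notation P := (mP C).
Local Notation Q := (mQ C).
Local Notation D := (left_dual HL).
Local Notation B := (base_change C L).
Local Notation E := (base_change C D).

Definition pair_pt p1 q1 (x : ldual L) q2 p2 (p3 : P) (q3 : Q) (l : L)
    (q4 : Q) (p4 : P) : S :=
  pq (ract p1 (x (src L (qp q2 p3) * l * eact L (qp q4 p2) (qp q1 p4)))) q3.

Lemma pair_pt_compatr p1 q1 (x : ldual L) q2 p2 :
  ccompat (pair_pt p1 q1 x q2 p2).
Proof.
split=> *; rewrite /pair_pt.
- move=> a u v; by rewrite qp_linr linearP !mul_linl ldual_lin ract_linr pq_linl.
- exact: pq_linr.
- move=> a u v; by rewrite mul_linr mul_linl ldual_lin ract_linr pq_linl.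
- move=> a u v; by rewrite qp_linl eact_linl mul_linr ldual_lin ract_linr pq_linl.
- move=> a u v; by rewrite qp_linr eact_linr mul_linr ldual_lin ract_linr pq_linl.
- by rewrite qpMr -pq_bal -ractM -!mulrA ldual_src_tgt.
- by rewrite qpMl qpMr -eactM !mulrA.
Qed.

Definition pair_fun p1 q1 (x : ldual L) q2 p2 : B -> S :=
  bsum (pair_pt p1 q1 x q2 p2).

Lemma pair_fun_lin p1 q1 x q2 p2 : linear (pair_fun p1 q1 x q2 p2).
Proof. exact: bsum_lin (pair_pt_compatr _ _ _ _ _). Qed.

Lemma pair_fun_pt p1 q1 x q2 p2 p3 q3 l q4 p4 :
  pair_fun p1 q1 x q2 p2 (bpt p3 q3 l q4 p4) = pair_pt p1 q1 x q2 p2 p3 q3 l q4 p4.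
Proof. exact: bsum_pt (pair_pt_compatr _ _ _ _ _). Qed.

Lemma pair_fun_tgt p1 q1 x q2 p2 v m :
  pair_fun p1 q1 x q2 p2 (tgt B v * m) = pair_fun p1 q1 x q2 p2 m * v.
Proof.
move: m; apply: bcop_ext.
- by apply: lin_comp; [apply: pair_fun_lin | apply: mul_linr].
- by apply: (lin_comp (mul_linl v)); apply: pair_fun_lin.
- by move=> p q l q' p'; rewrite tgt_bpt !pair_fun_pt /pair_pt pqMr.
Qed.

Definition pair_ldual p1 q1 x q2 p2 : ldual B :=
  LDual (@pair_fun_lin p1 q1 x q2 p2) (@pair_fun_tgt p1 q1 x q2 p2).

Lemma bldual_ext (y z : ldual B) :
  (forall p q l q1 p1, y (bpt p q l q1 p1) = z (bpt p q l q1 p1)) -> y = z.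
Proof.
by move=> yz; apply: ldual_ext; apply: bcop_ext yz; apply: ldual_lin.
Qed.

(** The relators over $R^e$ hold because the action on $L^\vee$ multiplies the value on the left and
    the argument on either side, which is where scalars from [p1], [q1], [q2], [p2] enter the
    pairing. *)
Lemma pair_ldual_compat :
  ccompat (fun p1 q1 (x : D) q2 p2 => pair_ldual p1 q1 x q2 p2).
Proof.
split=> *; try move=> a u v; apply: bldual_ext => *;
  rewrite ?ldual_ev_lin /= !pair_fun_pt /pair_pt.
- by rewrite ract_lin pq_linl.
- by rewrite qp_linl eact_linr mul_linr ldual_lin ract_linr pq_linl.
- by rewrite ldual_ev_lin ract_linr pq_linl.
- by rewrite qp_linl linearP !mul_linl ldual_lin ract_linr pq_linl.
- by rewrite qp_linr eact_linl mul_linr ldual_lin ract_linr pq_linl.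
- by rewrite eact_ldual -ractM qpMl /eact tgtM !mulrA.
- rewrite ldual_eact qpMl qpMr /eact !rmorphM -!mulrA.
  by rewrite -[tgt L _ * src L _ in LHS]src_tgtC.
Qed.

Definition dual_map (u : E) : ldual B :=
  bsum (fun p1 q1 (x : D) q2 p2 => pair_ldual p1 q1 x q2 p2) u.

Lemma dual_map_lin : linear dual_map.
Proof. exact: bsum_lin pair_ldual_compat. Qed.

Lemma dual_map_pt p1 q1 (x : D) q2 p2 p3 q3 l q4 p4 :
  dual_map (bpt p1 q1 x q2 p2) (bpt p3 q3 l q4 p4) =
  pq (ract p1 ((x : ldual L)
    (src L (qp q2 p3) * l * eact L (qp q4 p2) (qp q1 p4)))) q3.
Proof. by rewrite /dual_map (bsum_pt _ _ _ _ _ pair_ldual_compat) /= pair_fun_pt. Qed.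

(** Both sides become sums over [cop l]. On the right, the comultiplication of the base change
    spreads $p_j\otimes q^j$ over two legs; the Takeuchi condition of $L$ moves $q^jp_2$ to the
    first leg, where $p_j(q^jp_2)=p_2$. *)
Lemma dual_mapM (u v : E) : dual_map (u * v) = lmul (dual_map u) (dual_map v).
Proof.
move: u; apply: bcop_ext.
- by apply: lin_comp; [apply: dual_map_lin | apply: mul_linl].
- by apply: (lin_comp (lmul_linl _)); apply: dual_map_lin.
move=> p1 q1 x q2 p2; move: v; apply: bcop_ext.
- by apply: lin_comp; [apply: dual_map_lin | apply: mul_linr].
- by apply: (lin_comp (lmul_linr _)); apply: dual_map_lin.
move=> p3 q3 y q4 p4; apply: bldual_ext => p5 q5 l q6 p6.
rewrite B_bmul_pt dual_map_pt -mulrA.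
(* [s] isolates the target factor of the first leg: $q_3p_2$ on the left side, $q_3p_j$ on the
   right. *)
pose h s l1 l2 := pq (ract p1 ((x : ldual L) (src L (qp q2 p3 * (y : ldual L)
  (src L (qp q4 p5) * l1 * eact L (qp q6 p4) s)) * (l2 * tgt L (qp q1 p6))))) q5.
have h1 l1 l2 : linear (fun s => h s l1 l2).
  move=> a s t; rewrite /h eact_linr mul_linr ldual_lin mul_linr linearP mul_linl.
  by rewrite ldual_lin ract_linr pq_linl.
have hc s : dcompat (h s).
  split=> *; try move=> a u v; rewrite /h.
  - rewrite mul_linr mul_linl ldual_lin mul_linr linearP mul_linl.
    by rewrite ldual_lin ract_linr pq_linl.
  - by rewrite mul_linl mul_linr ldual_lin ract_linr pq_linl.
  - rewrite !mulrA src_tgtC -!(mulrA (tgt L _)).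
    by rewrite ldual_tgt (mulrA (qp q2 p3)) rmorphM.
transitivity (sum2 (h (qp q3 p2)) (cop l)).
  rewrite [LHS](_ : _ = pq (ract p1 ((x : ldual L) (lcoact
    (eact D (qp q2 p3) (qp q3 p2) * y) (src L (qp q4 p5) * l *
      eact L (qp q6 p4) (qp q1 p6))))) q5) // lcoact_src_eact.
  rewrite (sum2_comp _ _ (ldual_lin _)) (sum2_comp _ _ (ract_linr _)).
  rewrite (sum2_comp _ _ (pq_linl _)); apply: eq_sum2 => l1 l2.
  by rewrite eact_ldual /h /eact !mulrA.
transitivity (sum2 (fun pj qj => sum2 (fun l1 l2 =>
    h (qp q3 pj) l1 (l2 * src L (qp qj p2))) (cop l)) (fV C)).
  under [RHS]eq_sum2 => pj qj.
    rewrite -cop_takeuchiK //.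
    under eq_sum2 => l1 l2.
      rewrite (_ : h _ _ _ = h (qp q3 pj * qp qj p2) l1 l2); last first.
        by rewrite /h /eact !src_tgtC tgtM -!mulrA.
      rewrite -qpMr; over.
    over.
  rewrite [RHS]sum2_swap; apply: eq_sum2 => l1 l2.
  by rewrite -(sum2_comp _ _ (h1 _ _)) -(sum2_comp _ _ (qp_linr _)) fV_P.
rewrite /= /lcoact bcopK; last exact: (@lact_compat _ _ B).
rewrite [LHS]sum2_swap (sum2_comp _ _ (ldual_lin _)); apply: eq_sum2 => l1 l2.
rewrite (sum2_comp _ _ (ldual_lin _)); apply: eq_sum2 => pj qj.
have [bP _ _ _ _ _ _] := bpt_compat C L.
(* The value of the second functional ends in $q_i$ and acts on $p^i$, so $(pq_i)p^i=p$ removes the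
   sum over $g^{-1}(1)$. *)
rewrite /D0; under eq_sum2 => qi pi do rewrite src_bpt dual_map_pt.
rewrite -(sum2_comp _ _ (bP _ _ _ _)) gV_P dual_map_pt qpMr /h /eact.
by rewrite !mulrA.
Qed.

(** Unit, source and target are treated at once: the right side is $s\overline t$ times the counit
    functional. *)
Lemma dual_map_beact s t m :
  dual_map (beact C D s t) m = s * cou (m * tgt B t) 1.
Proof.
move: m; apply: bcop_ext => [||p3 q3 l q4 p4].
- exact: ldual_lin.
- by apply: (lin_comp (mul_linr s)); apply: (lin_comp (bcou_lin _)); apply: mul_linl.
rewrite bpt_tgt [cou _ _]bcou_pt ract1 /beact.
rewrite (sum2_comp _ _ dual_map_lin) (sum2_comp _ _ (@ldual_ev_lin _ _ _ _)).
transitivity (sum2 (fun pi qi =>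
    pq (ract (lact s pi) (qp qi p3 * cou l (qp q4 (lact t p4)))) q3) (fV C)).
  apply: eq_sum2 => pi qi.
  rewrite (sum2_comp _ _ dual_map_lin) (sum2_comp _ _ (@ldual_ev_lin _ _ _ _)).
  transitivity (sum2 (fun pj qj =>
      pq (ract (lact s pi) (qp qi p3 * cou l (qp q4 (ract pj (qp qj (lact t p4)))))) q3)
      (fV C)).
    apply: eq_sum2 => pj qj; rewrite dual_map_pt /= -mulrA cou_srcl couM cou_eact mulr1.
    by rewrite qpMr qp_bal.
  rewrite -(sum2_comp _ _ (pq_linl _)) -(sum2_comp _ _ (ract_linr _)).
  rewrite -(sum2_comp _ _ (mul_linr _)) -(sum2_comp _ _ (cou_linr _)).
  by rewrite -(sum2_comp _ _ (qp_linr _)) fV_P.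
under eq_sum2 => pi qi do rewrite ractM lractA.
rewrite -(sum2_comp _ _ (pq_linl _)) -(sum2_comp _ _ (ract_lin _)).
by rewrite -(sum2_comp _ _ (lact_lin _)) fV_P lractA pqMl.
Qed.

(** * The inverse map *)

(** The value in $S$ is carried to $R$ by $s\mapsto qsp^i$, while the partner $q_i$ fills the slot
    of [y] on which $\overline S$ acts. *)
Definition undual_fun (y : ldual B) q p q' p' (l : L) : R :=
  sum2 (fun qi pi => qp (ract q (y (bpt p qi l q' p'))) pi) (gV C).

Lemma undual_fun_lin y q p q' p' : linear (undual_fun y q p q' p').
Proof.
have [_ _ bL _ _ _ _] := bpt_compat C L.
by move=> a u v; apply: sum2_linP => *; rewrite bL ldual_lin ract_linr qp_linl.
Qed.

(** This is the centrality $rq_i\otimes p^i=q_i\otimes p^ir$; it applies because $\overline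
    S$-linearity of [y] makes the summand balanced over $S$. *)
Lemma undual_fun_tgt y q p q' p' v l :
  undual_fun y q p q' p' (tgt L v * l) = undual_fun y q p q' p' l * v.
Proof.
have [_ bQ _ _ _ _ _] := bpt_compat C L.
rewrite /undual_fun (sum2_comp _ _ (mul_linl _)).
under eq_sum2 => ? ? do rewrite -bpt_tgtl.
rewrite (gV_central (h := fun qi pi => qp (ract q (y (bpt p qi l q' p'))) pi)).
  by apply: eq_sum2 => ? ?; rewrite qpMr.
split=> *; try move=> a u w.
- by rewrite bQ ldual_lin ract_linr qp_linl.
- exact: qp_linr.
- by rewrite -tgt_bpt ldual_tgt ractM qp_bal.
Qed.

Definition undual_ldual y q p q' p' : ldual L :=
  LDual (@undual_fun_lin y q p q' p') (@undual_fun_tgt y q p q' p').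

(** One half of each copy of $f^{-1}(1)$ is an outer entry of the tensor; of the other halves, [pb],
    [pc], [qd] enter the argument of [y] and [qa] multiplies its value. *)
Definition undual (y : ldual B) : E :=
  sum2 (fun pa qa => sum2 (fun pb qb => sum2 (fun pc qc => sum2 (fun pd qd =>
    bpt pa qb (undual_ldual y qa pc qd pb : D) qc pd) (fV C)) (fV C)) (fV C)) (fV C).

Lemma undualK : cancel undual (@dual_map).
Proof.
have [bP bQ bL bQ1 bP1 _ _] := bpt_compat C L.
move=> y; apply: bldual_ext => p3 q3 l q4 p4.
transitivity (sum2 (fun pa qa => sum2 (fun pb qb => sum2 (fun pc qc => sum2 (fun pd qd =>
    dual_map (bpt pa qb (undual_ldual y qa pc qd pb : D) qc pd) (bpt p3 q3 l q4 p4))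
   (fV C)) (fV C)) (fV C)) (fV C)).
  do 4![rewrite (sum2_comp _ _ dual_map_lin) (sum2_comp _ _ (@ldual_ev_lin _ _ _ _));
    apply: eq_sum2 => ? ?].
  by [].
transitivity (sum2 (fun pa qa => sum2 (fun pb qb => sum2 (fun pc qc => sum2 (fun pd qd =>
    pq pa qa * y (bpt (ract pc (qp qc p3)) q3 l (lact (qp q4 pd) qd) (ract pb (qp qb p4))))
   (fV C)) (fV C)) (fV C)) (fV C)).
  do 4![apply: eq_sum2 => ? ?].
  rewrite dual_map_pt /= /undual_fun.
  rewrite (sum2_comp _ _ (ract_linr _)) (sum2_comp _ _ (pq_linl _)).
  (* The factor $p^iq_3$ enters [y] by $\overline S$-linearity, and there $q_i(p^iq_3)=q_3$. *)
  under eq_sum2 => qi pi.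
    rewrite -pqA pqMl pqMr -mulrA -ldual_tgt tgt_bpt; over.
  rewrite -(sum2_comp _ _ (mul_linr _)) -(sum2_comp _ _ (ldual_lin _)).
  rewrite -(sum2_comp _ _ (bQ _ _ _ _)) gV_Q.
  by rewrite (ccMr (bpt_compat C L)) -bpt_srcl.
transitivity (sum2 (fun pa qa => pq pa qa * y (bpt p3 q3 l q4 p4)) (fV C)).
  apply: eq_sum2 => pa qa.
  under eq_sum2 => pb qb.
    under eq_sum2 => pc qc.
      rewrite -(sum2_comp _ _ (mul_linr _)) -(sum2_comp _ _ (ldual_lin _)).
      rewrite -(sum2_comp _ _ (bQ1 _ _ _ _)) fV_Q; over.
    rewrite -(sum2_comp _ _ (mul_linr _)) -(sum2_comp _ _ (ldual_lin _)).
    rewrite -(sum2_comp _ _ (bP _ _ _ _)) fV_P; over.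
  rewrite -(sum2_comp _ _ (mul_linr _)) -(sum2_comp _ _ (ldual_lin _)).
  by rewrite -(sum2_comp _ _ (bP1 _ _ _ _)) fV_P.
by rewrite -(sum2_comp _ _ (mul_linl _)) sum_fV mul1r.
Qed.

Lemma undual_lin : linear undual.
Proof.
have [_ _ bL _ _ _ _] := bpt_compat C D.
move=> a y z; do 4![apply: sum2_linP => ? ?]; rewrite -bL.
congr bpt; apply: ldual_ext => l; rewrite ldual_ev_lin /=.
by apply: sum2_linP => ? ?; rewrite ldual_ev_lin ract_linr qp_linl.
Qed.

Lemma dual_mapK : cancel (@dual_map) undual.
Proof.
have [bP bQ bL bQ1 bP1 bMl bMr] := bpt_compat C D.
apply: bcop_ext => //.
  by apply: (lin_comp undual_lin); apply: dual_map_lin.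
move=> p1 q1 x q2 p2.
transitivity (sum2 (fun pa qa => sum2 (fun pb qb => sum2 (fun pc qc => sum2 (fun pd qd =>
    bpt (ract pa (qp qa p1)) (lact (qp q1 pb) qb) x (lact (qp q2 pc) qc)
      (ract pd (qp qd p2)))
   (fV C)) (fV C)) (fV C)) (fV C)).
  do 4![apply: eq_sum2 => ? ?].
  (* Balancing moves the four coefficients into the functional, leaving an equality in $L^\vee$ that
     rests on $q_ip^i=1$. *)
  rewrite bMl -bMr; congr bpt; apply: ldual_ext => l.
  rewrite ldual_eact eact_ldual /= /undual_fun.
  under eq_sum2 => qi pi do
    rewrite dual_map_pt -qpA qpMl qpMr.
  by rewrite -(sum2_comp _ _ (mul_linr _)) sum_gV mulr1 /eact !mulrA.
under eq_sum2 => pa qa.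
  under eq_sum2 => pb qb.
    under eq_sum2 => pc qc.
      rewrite -(sum2_comp _ _ (bP1 _ _ _ _)) fV_P; over.
    rewrite -(sum2_comp _ _ (bQ1 _ _ _ _)) fV_Q; over.
  rewrite -(sum2_comp _ _ (bQ _ _ _ _)) fV_Q; over.
by rewrite -(sum2_comp _ _ (bP _ _ _ _)) fV_P.
Qed.

(** * Projectivity of the base change *)

Lemma base_change_fgp : tgt_fgp B.
Proof.
have [bP bQ bL bQ1 bP1 bMl bMr] := bpt_compat C L.
have [n [e [c expand]]] := dual_basis HL.
pose F (u : B) : B := sum2 (fun pb qb => sum2 (fun pc qc => sum2 (fun pd qd =>
  \sum_j sum2 (fun qi pi =>
    tgt B (dual_map (bpt pi qb (c j : D) qc pd) u) * bpt pc qi (e j) qd pb)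
  (gV C)) (fV C)) (fV C)) (fV C).
have lF : linear F.
  move=> a u v; do 3![apply: sum2_linP => ? ?].
  rewrite scaler_sumr -big_split; apply: eq_bigr => j _.
  by apply: sum2_linP => ? ?; rewrite ldual_lin linearP mul_linl.
have {}lF : F =1 id.
  apply: bcop_ext => // p3 q3 l q4 p4.
  transitivity (sum2 (fun pb qb => sum2 (fun pc qc => sum2 (fun pd qd =>
      bpt (ract pc (qp qc p3)) q3 l (lact (qp q4 pd) qd) (ract pb (qp qb p4)))
    (fV C)) (fV C)) (fV C)).
    (* Moving the three coefficients inward makes the middle factor exactly the argument of [c j] in
       the pairing; this element is then expanded in the dual basis of $L$. *)
    do 3![apply: eq_sum2 => ? ?]; rewrite -bMr bpt_srcl mulrA.
    rewrite [in RHS](expand (_ * _)) (linf_sum (bL _ _ _ _)).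
    apply: eq_bigr => j _.
    under eq_sum2 => qi pi do rewrite dual_map_pt tgt_bpt pq_bal.
    by rewrite -(sum2_comp _ _ (bQ _ _ _ _)) gV_Q bpt_tgtl.
  under eq_sum2 => pb qb.
    under eq_sum2 => pc qc do rewrite -(sum2_comp _ _ (bQ1 _ _ _ _)) fV_Q.
    rewrite -(sum2_comp _ _ (bP _ _ _ _)) fV_P; over.
  by rewrite -(sum2_comp _ _ (bP1 _ _ _ _)) fV_P.
have [s sE] : finite_rank F.
  do 3![apply: finite_rank_sum2 => ? ?]; apply: finite_rank_sum => j.
  by apply: finite_rank_sum2 => ? ?; apply: finite_rank1.
by apply: finite_rank_id; exists s => u; rewrite -sE lF.
Qed.

(** * Compatibility with the bialgebra structures *)

Lemma dual_map_monoid : monoid_morphism (dual_map : E -> left_dual_ring B).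
Proof.
split=> [|u v]; last exact: dual_mapM.
apply: ldual_ext => m.
by rewrite [LHS]dual_map_beact mul1r tgt1 mulr1.
Qed.

HB.instance Definition _ :=
  GRing.isLinear.Build k E (left_dual_ring B) _ (@dual_map) dual_map_lin.
HB.instance Definition _ :=
  GRing.isMonoidMorphism.Build E (left_dual_ring B) (@dual_map) dual_map_monoid.

Lemma dual_map_src s : dual_map (src E s) = src (left_dual_ring B) s.
Proof. by apply: ldual_ext => m; rewrite [LHS]dual_map_beact tgt1 mulr1. Qed.

Lemma dual_map_tgt s : dual_map (tgt E s) = tgt (left_dual_ring B) s.
Proof. by apply: ldual_ext => m; rewrite [LHS]dual_map_beact mul1r. Qed.

Lemma dual_map_cou (u : E) s : ldcou (dual_map u : left_dual_ring B) s = cou u s.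
Proof.
rewrite /ldcou; move: u; apply: bcop_ext.
- by apply: (lin_comp (@ldual_ev_lin _ _ _ _)); apply: dual_map_lin.
- exact: bcou_lin.
move=> p1 q1 x q2 p2; rewrite [RHS]bcou_pt /= /ldcou /bsrc /beact.
transitivity (sum2 (fun pi qi => sum2 (fun pj qj =>
   pq (ract p1 ((x : ldual L) (src L (qp (ract q2 s) (ract pi (qp qi p2))))))
     (lact (qp q1 pj) qj)) (fV C)) (fV C)).
  do 2![rewrite (sum2_comp _ _ (ldual_lin _)); apply: eq_sum2 => ? ?].
  rewrite dual_map_pt ract1 mulr1 /eact mulrA -rmorphM src_tgtC ldual_tgt.
  by rewrite ractM pq_bal qpMr qp_bal.
under eq_sum2 => pi qi do rewrite -(sum2_comp _ _ (pq_linr _)) fV_Q.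
have lx : linear (fun p => pq (ract p1 ((x : ldual L) (src L (qp (ract q2 s) p)))) q1).
  by move=> a u v; rewrite qp_linr linearP ldual_lin ract_linr pq_linl.
by rewrite -(sum2_comp _ _ lx) fV_P.
Qed.

(** Finite projectivity of the base change lets evaluation at pairs separate elements of the diamond
    product. The computation then parallels that for products, with the Takeuchi condition of
    $L^\vee$ in place of that of $L$. *)
Lemma dual_map_cop (HB : tgt_fgp B) (u : E) :
  ldcop HB (dual_map u) =
  sum2 (fun v w : E => dpure (dual_map v : left_dual_ring B) (dual_map w)) (cop u).
Proof.
apply: (dpair_inj HB) => m n; rewrite dpair_cop.
rewrite [RHS](sum2_comp _ _ (dpair_lin m n)).
under [RHS]eq_sum2 => v w do rewrite dpairE.
have c m' n' : dcompat (fun v w : E => dual_map v (m' * tgt B (dual_map w n'))).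
  exact: (dcompat_morph (phi := dual_map : {lrmorphism E -> left_dual_ring B})
    dual_map_src dual_map_tgt (dpair_compat m' n')).
move: u; apply: bcop_ext.
- by apply: (lin_comp (@ldual_ev_lin _ _ _ _)); apply: dual_map_lin.
- exact: (lin_comp (dsum_linear (c m n)) (@bcop_lin _ _ _ C D)).
move=> p1 q1 x q2 p2; move: m; apply: bcop_ext.
- by apply: (lin_comp (ldual_lin _)); apply: mul_linl.
- by move=> a u v; apply: sum2_linP => ? ?; rewrite mul_linl ldual_lin.
move=> p3 q3 l q4 p4; move: n; apply: bcop_ext.
- by apply: (lin_comp (ldual_lin _)); apply: mul_linr.
- move=> a u v; apply: sum2_linP => ? ?.
  by rewrite ldual_lin linearP mul_linr ldual_lin.
move=> p5 q5 l' q6 p6.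
rewrite B_bmul_pt dual_map_pt bcopK //.
pose Y := l' * eact L (qp q6 p2) (qp q1 p6).
pose h a (x1 x2 : D) := pq (ract p1 ((x1 : ldual L) (src L (qp q2 p3) * l *
  eact L a ((x2 : ldual L) Y * qp q5 p4)))) q3.
have hc a : dcompat (h a).
  split=> *; try move=> b u v; rewrite /h.
  - by rewrite ldual_ev_lin ract_linr pq_linl.
  - by rewrite ldual_ev_lin mul_linl eact_linr mul_linr ldual_lin ract_linr pq_linl.
  - by rewrite dtgt_mul dsrc_mul /eact -[_ * _ * qp q5 p4]mulrA (tgtM _ _ (_ * _)) !mulrA.
have hl x1 x2 : linear (fun a => h a x1 x2).
  by move=> a u v; rewrite /h eact_linl mul_linr ldual_lin ract_linr pq_linl.
transitivity (sum2 (h (qp q4 p5)) (cop x)).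
  rewrite [X in (x : ldual L) X](_ : _ =
    src L (qp q2 p3) * l * src L (qp q4 p5) * (tgt L (qp q5 p4) * Y)); last first.
    by rewrite /Y /eact !mulrA.
  rewrite (ldcopE HL) (sum2_comp _ _ (ract_linr _)) (sum2_comp _ _ (pq_linl _)).
  by apply: eq_sum2 => x1 x2; rewrite ldual_tgt /h /eact !mulrA.
(* Right multiplication by a target element of $L^\vee$ is right translation by a source element of
   $L$, so the Takeuchi condition matches $q_4p_5$ with $(q_4p_j)(q^jp_5)$. *)
transitivity (sum2 (fun pj qj => sum2 (fun x1 x2 : D =>
    h (qp q4 pj) x1 (x2 * src D (qp qj p5))) (cop x)) (fV C)).
  under [RHS]eq_sum2 => pj qj.
    rewrite -cop_takeuchiK //.
    under eq_sum2 => x1 x2.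
      rewrite (_ : h _ _ _ = h (qp q4 pj * qp qj p5) x1 x2); last first.
        by rewrite /h dmul_tgt /eact rmorphM -!mulrA src_tgtC.
      rewrite -qpMr; over.
    over.
  rewrite [RHS]sum2_swap; apply: eq_sum2 => x1 x2.
  by rewrite -(sum2_comp _ _ (hl _ _)) -(sum2_comp _ _ (qp_linr _)) fV_P.
rewrite [LHS]sum2_swap; apply: eq_sum2 => x1 x2; apply: eq_sum2 => pj qj.
(* [t] marks the slot of $q_i$. The value of the second functional starts with $p^i$ and reaches
   $q_i$ through the target action on [p4], so $q_i(p^iq)=q$ applies. *)
pose g t := pq (ract p1 ((x1 : ldual L) (src L (qp q2 p3) * l *
  eact L (qp q4 pj) (qp t p4)))) q3.
have gl : linear g.
  by move=> a u v; rewrite /g qp_linl eact_linr mul_linr ldual_lin ract_linr pq_linl.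
transitivity (sum2 (fun qi pi => g (ract qi (pq pi (lact
  ((x2 : ldual L) (src L (qp qj p5) * Y)) q5)))) (gV C)).
  by rewrite -(sum2_comp _ _ gl) gV_Q /g qpMl /h dmul_src.
apply: eq_sum2 => qi pi.
by rewrite /g dual_map_pt bpt_tgt dual_map_pt qp_bal -(pq_bal pi) /Y mulrA.
Qed.

End Duality.

Theorem proposition5p4 (k : comNzRingType) (R S : algType k)
    (C : morita_context R S) (L : xbialgebra R) (HL : tgt_fgp L) :
  exists HLt : tgt_fgp (base_change C L),
    xiso (left_dual HLt) (base_change C (left_dual HL)).
Proof.
exists (base_change_fgp C HL); apply: xiso_sym.
exists (@dual_map k R S C L HL :
  {lrmorphism base_change C (left_dual HL) -> left_dual_ring (base_change C L)}).
split.
- by exists (@undual k R S C L HL); [apply: dual_mapK | apply: undualK].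
- exact: dual_map_src.
- exact: dual_map_tgt.
- exact: dual_map_cop.
- by move=> u; apply: funext => s; apply: dual_map_cou.
Qed.
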